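(* Let $m,n\ge1$. Then $K_m\vee P_n$ is determined by its $A_\alpha$-spectrum for every $\alpha\in(1/2,1)$.
   Context: All graphs are finite, simple and undirected. $A_\alpha(G)=\alpha D(G)+(1-\alpha)A(G)$ with $A(G)$ the adjacency and $D(G)$ the degree matrix. A graph is determined by its $A_\alpha$-spectrum if every graph whose $A_\alpha$ matrix has the same multiset of eigenvalues is isomorphic to it. $K_m$ is the complete graph, $P_n$ the path on $n$ vertices, and $\vee$ the join (disjoint union plus all edges between the two vertex sets). *)

(* Defs.v *)
From HB Require Import structures.
From mathcomp Require Import all_boot all_order all_algebra.
Set Implicit Arguments. Unset Strict Implicit. Unset Printing Implicit Defensive.
Import Order.TTheory GRing.Theory Num.Theory.
Local Open Scope ring_scope.

Definition simple_graph (k : nat) (e : rel 'I_k) : Prop :=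
  (forall x y, e x y = e y x) /\ (forall x, e x x = false).

Definition deg (k : nat) (e : rel 'I_k) (i : 'I_k) : nat := #|[set j | e i j]|.

Definition adj_mx (R : nzRingType) (k : nat) (e : rel 'I_k) : 'M[R]_k :=
  \matrix_(i, j) (e i j)%:R.
Definition deg_mx (R : nzRingType) (k : nat) (e : rel 'I_k) : 'M[R]_k :=
  \matrix_(i, j) ((i == j)%:R * (deg e i)%:R).

Definition A_alpha (R : comNzRingType) (alpha : R) (k : nat) (e : rel 'I_k) : 'M[R]_k :=
  alpha *: deg_mx R e + (1 - alpha) *: adj_mx R e.

(* Two graphs have the same A_alpha-spectrum (same multiset of eigenvalues,
   counted with multiplicity) iff their A_alpha characteristic polynomials
   coincide (this also forces equal orders, as char_poly has degree k). *)
Definition Aalpha_cospectral (R : comNzRingType) (alpha : R)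
    (k k' : nat) (e : rel 'I_k) (e' : rel 'I_k') : Prop :=
  char_poly (A_alpha alpha e) = char_poly (A_alpha alpha e').

Definition graph_iso (k k' : nat) (e : rel 'I_k) (e' : rel 'I_k') : Prop :=
  exists f : 'I_k -> 'I_k', bijective f /\ forall x y, e' (f x) (f y) = e x y.

(* K_m \/ P_n on vertex set 'I_(m+n): vertices 0..m-1 form the clique K_m,
   vertices m..m+n-1 form the path P_n (m - m+1 - ... - m+n-1), and every
   clique vertex is joined to every path vertex. *)
Definition join_KP_rel (m n : nat) : rel 'I_(m + n) :=
  fun i j => (i != j) &&
    [|| (i < m)%N, (j < m)%N, (i.+1 == j) | (j.+1 == i)].

Definition DAS (R : comNzRingType) (alpha : R) (k : nat) (e : rel 'I_k) : Prop :=
  forall (k' : nat) (e' : rel 'I_k'), simple_graph e' ->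
    Aalpha_cospectral alpha e' e -> graph_iso e' e.
Arguments join_KP_rel : clear implicits.

(* Main.v *)
Require Import Defs.
From HB Require Import structures.
From mathcomp Require Import all_boot all_order all_algebra.
From mathcomp Require Import complex ring lra zify.
Set Implicit Arguments. Unset Strict Implicit. Unset Printing Implicit Defensive.
Import Order.TTheory GRing.Theory Num.Theory.
Local Open Scope ring_scope.

(* Write b = 1 - alpha, N = m + n, and let G' be cospectral with K_m \/ P_n.

   On vectors of sum zero, A_alpha(G') is (alpha N - 1) I minus A_alpha of the complement, which
   for alpha > 1/2 is positive semidefinite with kernel the vectors supported on the dominating
   vertices of G'.  Counting eigenvalues >= alpha N - 1 shows that G' has at least m dominating
   vertices, except possibly when m = 1 and G' has none.  That case is excluded by the first three
   spectral moments: they fix the sum of d and of d^2 and relate the sum of d^3 to the number of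
   triangles, and without a vertex of degree n the sum of d^3 is too small to be compensated.

   So G' = K_m \/ H, and the first two moments give (sum over H) (d - 1)(d - 2) = 0, hence H is the
   union of one path P_a and a 2-regular graph.  Let lam be the common top eigenvalue.  Summing the
   eigenvalue equation over the clique and over H determines, after normalization, the sum of
   the values of the eigenvector at the two ends of the path component, by lam, m and n only.
   Symmetrizing the eigenvector along that component gives a sequence satisfying
   u_(i+2) = tau u_(i+1) - u_i with tau > 2, whose initial values are the same for
   P_a and P_n, and which is symmetric about the middle of both.  If a < n it is periodic,
   hence zero, a contradiction. *)

(** * Diagonalization of real symmetric matrices *)

(** The matrix is hermitian over [R[i]], so its spectral diagonal is real. A diagonal entry is a
    root of the characteristic polynomial over [R[i]] and, being real, already over [R]. *)
Lemma symmetric_eigenvalue (R : rcfType) (n : nat) (A : 'M[R]_n.+1) :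
  A^T = A -> exists a, eigenvalue A a.
Proof.
move=> sA; pose f : {rmorphism R -> R[i]} := real_complex R.
have hA : map_mx f A \is hermsymmx.
  apply: realsym_hermsym.
    by apply/is_hermitianmxP; rewrite expr0 scale1r map_mx_id // map_trmx sA.
  by apply/mxOverP=> i j; rewrite mxE; apply/complex_realP; exists (A i j).
have /mxOverP/(_ 0 0)/complex_realP[a Ea] := hermitian_spectral_diag_real hA.
exists a; rewrite eigenvalue_root_char -(fmorph_root f) map_char_poly.
rewrite -eigenvalue_root_char; apply/eigenvalueP.
have /orthomx_spectralP E := hermitian_normalmx hA.
set P := spectralmx _ in E; set d := spectral_diag _ in E Ea.
have uP : P \in unitmx := spectral_unit _.
exists (row 0 P).
  rewrite {1}E rowE !mulmxA mulmxK //.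
  have -> : delta_mx 0 0 *m diag_mx d = d 0 0 *: delta_mx 0 0 :> 'rV_n.+1.
    apply/rowP=> j; rewrite mul_mx_diag !mxE eqxx /=.
    by case: eqVneq => [->|]; rewrite ?mulr1 ?mul1r ?mulr0 ?mul0r.
  by rewrite -scalemxAl Ea.
apply/eqP=> r0; have /eqP : delta_mx 0 0 = 0 :> 'rV[R[i]]_n.+1.
  by rewrite -(mulmxK uP (delta_mx 0 0)) -rowE r0 mul0mx.
by move/eqP/rowP/(_ 0); rewrite !mxE !eqxx => /eqP; rewrite oner_eq0.
Qed.

(** The Householder reflection along w = e0 - v exchanges the unit vectors e0 and v, so its first
    row is v. *)
Lemma orthogonal_completion (R : rcfType) (n : nat) (v : 'rV[R]_n.+1) :
  v *m v^T = 1%:M -> exists2 Q : 'M[R]_n.+1, Q *m Q^T = 1%:M & row 0 Q = v.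
Proof.
move=> vv; pose e0 : 'rV[R]_n.+1 := delta_mx 0 0; pose w := e0 - v.
have [w0|wn0] := eqVneq w 0.
  exists 1%:M; first by rewrite trmx1 mulmx1.
  by rewrite rowE mulmx1; apply/eqP; rewrite -subr_eq0 -/w w0.
pose q : R := (w *m w^T) 0 0.
have ee : e0 *m e0^T = 1%:M.
  by apply/matrixP=> i j; rewrite !ord1 /e0 trmx_delta mul_delta_mx !mxE !eqxx.
have Ew : w *m w^T = q%:M by rewrite [LHS]mx11_scalar.
have e0w : e0 *m w^T = (1 - v 0 0)%:M.
  rewrite [w^T]linearB /= mulmxBr ee [RHS]raddfB /=; congr (_ - _).
  by rewrite -rowE [LHS]mx11_scalar !mxE.
have qE : q = 2 * (1 - v 0 0).
  have ve : v *m e0^T = (v 0 0)%:M.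
    by rewrite [LHS]mx11_scalar -[v *m _]trmxK trmx_mul trmxK -rowE !mxE.
  rewrite /q mulmxBl e0w [w^T]linearB /= mulmxBr vv ve !mxE eqxx /= mulr1n; ring.
have q0 : q != 0.
  apply: contra wn0 => /eqP qq; apply/eqP/rowP=> j; rewrite [RHS]mxE.
  have : \sum_j w 0 j ^+ 2 = 0.
    by rewrite -[RHS]qq /q mxE; apply: eq_bigr => i _; rewrite !mxE.
  have sq_ge0 i : true -> 0 <= w 0 i ^+ 2 by rewrite sqr_ge0.
  by move/(psumr_eq0P sq_ge0)/(_ j isT)/eqP; rewrite sqrf_eq0 => /eqP.
have vE : e0 - w = v by rewrite /w opprB addrC subrK.
clearbody q w; exists (1%:M - (2 / q) *: (w^T *m w)).
  rewrite [(1%:M - _)^T]linearB /= trmx1 [(_ *: _)^T]linearZ /= trmx_mul trmxK.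
  rewrite mulmxBl mul1mx mulmxBr mulmx1 -scalemxAl -scalemxAr -mulmxA (mulmxA w).
  rewrite Ew mul_scalar_mx -!scalemxAr !scalerA.
  have -> : 2 / q * (2 / q * q) = 2 / q + 2 / q :> R by field.
  by rewrite scalerDl opprB addrK subrK.
rewrite rowE mulmxBr mulmx1 -scalemxAr mulmxA -/e0 e0w mul_scalar_mx scalerA.
rewrite [X in X *: _](_ : _ = 1) ?scale1r //.
by have := q0; rewrite qE mulf_eq0 => /norP[_ h]; field.
Qed.

(** Deflation: in an orthonormal basis starting with a unit eigenvector, symmetry clears the first
    row and column off the diagonal, and induction applies to the remaining block. *)
Lemma symmetric_diagonalization (R : rcfType) (n : nat) (A : 'M[R]_n) :
  A^T = A -> exists (P : 'M[R]_n) (d : 'rV[R]_n), P *m P^T = 1%:M /\ A = P^T *m diag_mx d *m P.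
Proof.
elim: n A => [|n IHn] A sA.
  by exists 1%:M, 0; split; [rewrite trmx1 mulmx1 | apply/matrixP=> -[]].
have [a /eigenvalueP[u uA u0]] := symmetric_eigenvalue sA.
have uu_gt0 : 0 < (u *m u^T) 0 0.
  have [j uj] : exists j, u 0 j != 0 by apply/rV0Pn.
  rewrite mxE (bigD1 j) //= ltr_pwDl //.
    by rewrite mxE -expr2 exprn_even_gt0.
  by apply: sumr_ge0 => i _; rewrite mxE -expr2 sqr_ge0.
pose r := Num.sqrt ((u *m u^T) 0 0); pose v := r^-1 *: u.
have r0 : r != 0 by rewrite gt_eqF // sqrtr_gt0.
have vv : v *m v^T = 1%:M.
  rewrite [v^T]linearZ /= -scalemxAl -scalemxAr scalerA [u *m _]mx11_scalar.
  rewrite scale_scalar_mx -(sqr_sqrtr (ltW uu_gt0)) -/r.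
  by congr (_%:M); field.
have vA : v *m A = a *: v by rewrite -scalemxAl uA scalerA mulrC -scalerA.
have [Q QQ Q0] := orthogonal_completion vv.
have QQ' : Q^T *m Q = 1%:M by apply: mulmx1C.
pose B : 'M[R]_(1 + n) := Q *m A *m Q^T.
have sB : B^T = B by rewrite /B !trmx_mul trmxK sA mulmxA.
have B0 j : B 0 j = a * (0 == j)%:R.
  have -> : B 0 j = (row 0 B) 0 j by rewrite [RHS]mxE.
  rewrite /B 2!row_mul Q0 vA -scalemxAl -Q0 -row_mul QQ row1 !mxE eqxx /=.
  by rewrite eq_sym.
have EA : A = Q^T *m B *m Q by rewrite /B !mulmxA QQ' mul1mx -mulmxA QQ' mulmx1.
clearbody B.
have EB : B = block_mx a%:M 0 0 (drsubmx B).
  rewrite -[LHS]submxK; congr block_mx.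
  - apply/matrixP=> i j; rewrite !ord1 !mxE /= [X in B X _](_ : _ = 0); last exact: val_inj.
    by rewrite B0 -val_eqE /= mulr1.
  - apply/matrixP=> i j; rewrite !ord1 !mxE /= [X in B X _](_ : _ = 0); last exact: val_inj.
    by rewrite B0 -val_eqE /= mulr0.
  - apply/matrixP=> i j; rewrite !ord1 !mxE /= [X in B _ X](_ : _ = 0); last exact: val_inj.
    by rewrite -sB mxE B0 -val_eqE /= mulr0.
have [P' [d' [PP' EB']]] := IHn _ (etrans (trmx_drsub _) (congr1 _ sB)).
pose K : 'M[R]_(1 + n) := block_mx 1%:M 0 0 P'.
pose d : 'rV[R]_(1 + n) := row_mx a%:M d'.
have KK : K *m K^T = 1%:M.
  rewrite /K tr_block_mx mulmx_block !trmx0 !trmx1 !mulmx0 !mul0mx mulmx1.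
  by rewrite !addr0 add0r PP' -scalar_mx_block.
have KB : B = K^T *m diag_mx d *m K.
  rewrite EB EB' /K /d tr_block_mx diag_mx_row !mulmx_block !trmx0 !trmx1.
  rewrite !mulmx0 !mul0mx !mulmx1 !mul1mx !addr0 !add0r.
  congr block_mx; rewrite ?mul0mx //.
  by apply/matrixP=> i j; rewrite !ord1 !mxE.
clearbody K d; exists (K *m (Q : 'M_(1 + n))), d; split.
  by rewrite trmx_mul mulmxA -[X in X *m _]mulmxA QQ mulmx1.
by rewrite EA KB trmx_mul !mulmxA.
Qed.

Definition qform (R : nzRingType) (N : nat) (A : 'M[R]_N) (x : 'rV[R]_N) : R :=
  (x *m A *m x^T) 0 0.

Definition sqnorm (R : nzRingType) (N : nat) (x : 'rV[R]_N) : R :=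
  \sum_i x 0 i ^+ 2.

Lemma sqnormE (R : nzRingType) (N : nat) (x : 'rV[R]_N) :
  sqnorm x = (x *m x^T) 0 0.
Proof. by rewrite mxE; apply: eq_bigr => i _; rewrite mxE expr2. Qed.

Lemma exists_left_kernel (F : fieldType) (p q : nat) (M : 'M[F]_(p, q)) :
  (q < p)%N -> exists2 y : 'rV[F]_p, y != 0 & y *m M = 0.
Proof.
move=> qp; have : kermx M != 0.
  by rewrite -mxrank_eq0 mxrank_ker subn_eq0 -ltnNge (leq_ltn_trans (rank_leq_col _)).
case/rowV0Pn=> y /sub_kermxP yM y0; by exists y.
Qed.

(** * Rayleigh quotients and eigenvalue counts in an orthonormal eigenbasis *)

Section Diagonalized.
Variables (R : rcfType) (N : nat) (P : 'M[R]_N) (d : 'rV[R]_N).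
Hypothesis PPt : P *m P^T = 1%:M.
Let A := P^T *m diag_mx d *m P.

Lemma orthogonal_tr_mul : P^T *m P = 1%:M.
Proof. exact: mulmx1C. Qed.

Lemma char_poly_diagonalized : char_poly A = \prod_i ('X - (d 0 i)%:P).
Proof.
have <- : char_poly (diag_mx d) = \prod_i ('X - (d 0 i)%:P).
  rewrite char_poly_trig ?diag_mx_is_trig //.
  by apply: eq_bigr => i _; rewrite mxE eqxx.
rewrite /char_poly /char_poly_mx.
have -> : 'X%:M - map_mx polyC A =
    map_mx polyC P^T *m ('X%:M - map_mx polyC (diag_mx d)) *m map_mx polyC P.
  rewrite /A !map_mxM mulmxBr mulmxBl; congr (_ - _).
  by rewrite mul_mx_scalar -scalemxAl -map_mxM orthogonal_tr_mul map_mx1 scalemx1.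
rewrite !det_mulmx mulrC mulrA -det_mulmx -map_mxM PPt map_mx1 det1 mul1r //.
Qed.

Lemma mxtrace_diagonalized : \tr A = \sum_i d 0 i.
Proof. by rewrite /A mxtrace_mulC mulmxA PPt mul1mx mxtrace_diag. Qed.

Lemma mxtrace2_diagonalized : \tr (A *m A) = \sum_i d 0 i ^+ 2.
Proof.
have -> : A *m A = P^T *m (diag_mx d *m diag_mx d) *m P.
  by rewrite /A -!mulmxA (mulmxA P) PPt mul1mx.
rewrite mxtrace_mulC (mulmxA P) PPt mul1mx mulmx_diag mxtrace_diag.
by apply: eq_bigr => i _; rewrite mxE expr2.
Qed.

Lemma mxtrace3_diagonalized : \tr (A *m A *m A) = \sum_i d 0 i ^+ 3.
Proof.
have -> : A *m A *m A = P^T *m (diag_mx d *m diag_mx d *m diag_mx d) *m P.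
  by rewrite /A -!mulmxA (mulmxA P) PPt mul1mx (mulmxA P) PPt mul1mx.
rewrite mxtrace_mulC (mulmxA P) PPt mul1mx !mulmx_diag mxtrace_diag.
by apply: eq_bigr => i _; rewrite !mxE; ring.
Qed.

Lemma qform_diagonalized x : qform A x = \sum_i d 0 i * (x *m P^T) 0 i ^+ 2.
Proof.
have -> : qform A x = ((x *m P^T) *m diag_mx d *m (x *m P^T)^T) 0 0.
  by rewrite /qform /A trmx_mul trmxK !mulmxA.
rewrite mul_mx_diag mxE; apply: eq_bigr => i _.
by rewrite [X in X * _]mxE [X in _ * X]mxE; ring.
Qed.

Lemma sqnorm_orthogonal x : sqnorm x = \sum_i (x *m P^T) 0 i ^+ 2.
Proof.
rewrite -[RHS]/(sqnorm (x *m P^T)) !sqnormE trmx_mul trmxK -mulmxA (mulmxA P^T).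
by rewrite orthogonal_tr_mul mul1mx.
Qed.

Lemma eigenvector_diagonalized i : row i P *m A = d 0 i *: row i P.
Proof.
rewrite -row_mul /A !mulmxA PPt mul1mx row_mul.
by rewrite row_diag_mx -scalemxAl -rowE.
Qed.

Lemma row_orthogonal_neq0 i : row i P != 0.
Proof.
apply/eqP=> r0; have /rowP/(_ i) : row i (P *m P^T) = 0 by rewrite row_mul r0 mul0mx.
by rewrite PPt !mxE eqxx => /eqP; rewrite oner_eq0.
Qed.

(** With z the coordinates of x in the eigenbasis, the gap is the sum of the nonnegative terms (c -
    d_i) z_i^2. All of them vanish, so z lives on the eigenvalues equal to c. *)
Lemma qform_eq_max (c : R) x : (forall i, d 0 i <= c) ->
  qform A x = c * sqnorm x -> x *m A = c *: x.
Proof.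
move=> dc; rewrite qform_diagonalized sqnorm_orthogonal mulr_sumr => /esym/eqP.
rewrite -subr_eq0 -sumrB => /eqP s0.
have ge0 i : true -> 0 <= c * (x *m P^T) 0 i ^+ 2 - d 0 i * (x *m P^T) 0 i ^+ 2.
  by rewrite -mulrBl mulr_ge0 ?sqr_ge0 ?subr_ge0.
have z i : d 0 i * (x *m P^T) 0 i = c * (x *m P^T) 0 i.
  have /(_ i isT)/eqP := psumr_eq0P ge0 s0.
  rewrite -mulrBl mulf_eq0 subr_eq0 sqrf_eq0 => /orP[/eqP->//|/eqP->].
  by rewrite !mulr0.
rewrite -[x in RHS]mulmx1 -orthogonal_tr_mul (mulmxA x) scalemxAl /A !mulmxA.
by congr (_ *m P); apply/rowP=> i; rewrite mul_mx_diag [LHS]mxE mulrC z -scalemxAl [RHS]mxE.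
Qed.

Lemma qform_le_max (c : R) x : (forall i, d 0 i <= c) -> qform A x <= c * sqnorm x.
Proof.
move=> dc; rewrite qform_diagonalized sqnorm_orthogonal mulr_sumr.
by apply: ler_sum => i _; rewrite ler_wpM2r ?sqr_ge0.
Qed.

(** If fewer than [p] eigenvalues were at least [c], some nonzero vector in the row space of [U]
    would be orthogonal to all their eigenvectors, and its Rayleigh quotient would be below [c]. *)
Lemma card_ge_spectrum (c : R) (p : nat) (U : 'M[R]_(p, N)) : row_free U ->
  (forall y : 'rV_p, c * sqnorm (y *m U) <= qform A (y *m U)) ->
  (p <= #|[pred i | (c <= d 0 i)%R]|)%N.
Proof.
move=> fU hU; rewrite leqNgt; apply/negP.
set I := [pred i | _] => lt_p.
have [y y0 yM] := exists_left_kernel (colsub (@enum_val _ I) (U *m P^T)) lt_p.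
pose z := y *m U *m P^T.
have zI i : i \in I -> z 0 i = 0.
  move=> iI; have /rowP/(_ (enum_rank_in iI i)) := yM.
  by rewrite mulmx_colsub mulmxA -/z [colsub _ _ _ _]mxE enum_rankK_in // [in X in _ = X -> _]mxE.
have z0 : z != 0.
  apply: contraNneq y0 => z0; rewrite -(mulmxKp fU y) -(mulmx1 (y *m U)).
  by rewrite -orthogonal_tr_mul (mulmxA _ P^T) -/z z0 !mul0mx.
have [j zj] := rV0Pn _ z0.
have := hU y; rewrite qform_diagonalized sqnorm_orthogonal -/z mulr_sumr leNgt.
case/negP; rewrite [X in X < _](bigD1 j) //= [X in _ < X](bigD1 j) //=.
apply: ltr_leD.
  rewrite ltr_pM2r ?exprn_even_gt0 //.
  by rewrite ltNge; apply: contra zj => cd; rewrite zI.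
apply: ler_sum => i _; case: (boolP (i \in I)) => [/zI ->|].
  by rewrite expr0n /= !mulr0.
by rewrite inE -ltNge => /ltW h; rewrite ler_wpM2r ?sqr_ge0.
Qed.

(** If more than [q] eigenvalues were at least [c], their eigenvectors would span a nonzero vector
    satisfying the [q] linear conditions of [L], with Rayleigh quotient at least [c]. *)
Lemma card_ge_spectrum_le (c : R) (q : nat) (L : 'M[R]_(N, q)) :
  (forall x : 'rV_N, x != 0 -> x *m L = 0 -> qform A x < c * sqnorm x) ->
  (#|[pred i | (c <= d 0 i)%R]| <= q)%N.
Proof.
move=> hL; rewrite leqNgt; apply/negP.
set I := [pred i | _] => lt_q.
have [y y0 yM] := exists_left_kernel (rowsub (@enum_val _ I) P *m L) lt_q.
rewrite mulmxA in yM; set x := y *m _ in yM.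
have xP : x *m P^T = y *m rowsub (@enum_val _ I) 1%:M.
  by rewrite -mulmxA mul_rowsub_mx PPt.
have zI i : i \notin I -> (x *m P^T) 0 i = 0.
  move=> iI; rewrite xP mxE big1 // => k _; rewrite !mxE.
  by case: eqP => [E|]; rewrite ?mulr0 //; rewrite -E enum_valP in iI.
have x0 : x != 0.
  apply: contraNneq y0 => x0; apply/eqP/rowP=> k.
  have /rowP/(_ (enum_val k)) := xP; rewrite x0 mul0mx !mxE (bigD1 k) //= !mxE eqxx.
  rewrite mulr1 big1 ?addr0 // => k' k'k; rewrite !mxE.
  by rewrite (inj_eq enum_val_inj) (negPf k'k) mulr0.
have := hL x x0 yM; rewrite ltNge => /negP; apply.
rewrite qform_diagonalized sqnorm_orthogonal mulr_sumr; apply: ler_sum => i _.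
case: (boolP (i \in I)) => [iI|/zI ->]; last by rewrite expr0n /= !mulr0.
by rewrite ler_wpM2r ?sqr_ge0.
Qed.

End Diagonalized.

Lemma diagonalized_cospectral (R : rcfType) (N : nat) (P P' : 'M[R]_N)
    (d d' : 'rV[R]_N) :
  P *m P^T = 1%:M -> P' *m P'^T = 1%:M ->
  char_poly (P^T *m diag_mx d *m P) = char_poly (P'^T *m diag_mx d' *m P') ->
  perm_eq [seq d 0 i | i : 'I_N] [seq d' 0 i | i : 'I_N].
Proof.
move=> PP PP'; rewrite !char_poly_diagonalized // => E.
by apply: prod_XsubC_eq; rewrite !big_image.
Qed.

(** * What cospectral symmetric matrices share: moments, inertia and top eigenvalue *)

Section Cospectral.
Variables (R : rcfType) (N : nat) (A B : 'M[R]_N).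
Hypotheses (sA : A^T = A) (sB : B^T = B) (AB : char_poly A = char_poly B).

Lemma cospectral_traces :
  [/\ \tr A = \tr B, \tr (A *m A) = \tr (B *m B) &
      \tr (A *m A *m A) = \tr (B *m B *m B)].
Proof.
have [P [d [PP EA]]] := symmetric_diagonalization sA.
have [Q [e [QQ EB]]] := symmetric_diagonalization sB.
move: AB; rewrite EA EB => /(diagonalized_cospectral PP QQ) pe.
rewrite !mxtrace_diagonalized // !mxtrace2_diagonalized // !mxtrace3_diagonalized //.
have sumE (f : R -> R) : \sum_i f (d 0 i) = \sum_i f (e 0 i).
  have : \sum_(t <- [seq d 0 i | i : 'I_N]) f t = \sum_(t <- [seq e 0 i | i : 'I_N]) f t.
    exact: perm_big.
  by rewrite !big_image.
by split; [exact: (sumE id) | exact: (sumE (fun t => t ^+ 2))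
  | exact: (sumE (fun t => t ^+ 3))].
Qed.

Lemma cospectral_inertia (c : R) (p q : nat) (U : 'M[R]_(p, N)) (L : 'M[R]_(N, q)) :
  row_free U ->
  (forall y : 'rV_p, c * sqnorm (y *m U) <= qform A (y *m U)) ->
  (forall x : 'rV_N, x != 0 -> x *m L = 0 -> qform B x < c * sqnorm x) ->
  (p <= q)%N.
Proof.
have [P [d [PP EA]]] := symmetric_diagonalization sA.
have [Q [e [QQ EB]]] := symmetric_diagonalization sB.
move: AB; rewrite EA EB => /(diagonalized_cospectral PP QQ) pe.
move=> fU /(card_ge_spectrum PP fU) le_p /(card_ge_spectrum_le QQ) le_q.
apply: leq_trans le_p (leq_trans _ le_q).
have cE (f : 'rV[R]_N) :
    #|[pred i | (c <= f 0 i)%R]| = count (fun t => c <= t) [seq f 0 i | i : 'I_N].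
  by rewrite count_map -size_filter cardE enumT.
by rewrite !cE (permP pe).
Qed.

(** [c] is the common largest eigenvalue. Its variational description for [B] allows lower bounds on
    it by test vectors. *)
Lemma cospectral_top : (0 < N)%N ->
  exists c : R, [/\ exists2 x : 'rV_N, x != 0 & x *m A = c *: x,
    exists2 x : 'rV_N, x != 0 & x *m B = c *: x,
    forall x, qform B x <= c * sqnorm x &
    forall x, qform B x = c * sqnorm x -> x *m B = c *: x].
Proof.
move=> N0.
have [P [d [PP EA]]] := symmetric_diagonalization sA.
have [Q [e [QQ EB]]] := symmetric_diagonalization sB.
move: AB; rewrite EA EB => /(diagonalized_cospectral PP QQ) pe.
pose i0 : 'I_N := Ordinal N0.
pose i1 := [arg max_(i > i0) d 0 i]%O.
have dmax i : d 0 i <= d 0 i1.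
  by rewrite /i1; case: arg_maxP => //= j _ /(_ i isT).
have emax i : e 0 i <= d 0 i1.
  have : e 0 i \in [seq d 0 i | i : 'I_N] by rewrite (perm_mem pe) image_f.
  by case/imageP=> j _ ->.
have /imageP[j1 _ ej1] : d 0 i1 \in [seq e 0 i | i : 'I_N].
  by rewrite -(perm_mem pe) image_f.
exists (d 0 i1); split.
- by exists (row i1 P); rewrite ?row_orthogonal_neq0 ?eigenvector_diagonalized.
- exists (row j1 Q); first by rewrite row_orthogonal_neq0.
  by rewrite eigenvector_diagonalized // ej1.
- by move=> x; apply: qform_le_max.
- by move=> x; apply: qform_eq_max.
Qed.

End Cospectral.

(** * The matrix A_alpha *)

Definition dominating (k : nat) (e : rel 'I_k) : pred 'I_k :=
  fun v => [forall j, (j != v) ==> e v j].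

(* Twice the number of triangles through [i]. *)
Definition triwalks (k : nat) (e : rel 'I_k) (i : 'I_k) : nat :=
  (\sum_j \sum_l [&& e i j, e j l & e i l])%N.

Lemma adj_sym (k : nat) (e : rel 'I_k) : simple_graph e -> forall x y, e x y = e y x.
Proof. by case. Qed.

Lemma adj_irr (k : nat) (e : rel 'I_k) : simple_graph e -> forall x, e x x = false.
Proof. by case. Qed.

Lemma deg_sum (k : nat) (e : rel 'I_k) i : deg e i = (\sum_j e i j)%N.
Proof. by rewrite /deg -sum1dep_card big_mkcond /=; apply: eq_bigr => j _; case: (e i j). Qed.

Lemma degR (R : pzRingType) (k : nat) (e : rel 'I_k) i :
  (deg e i)%:R = \sum_j (e i j)%:R :> R.
Proof. by rewrite deg_sum natr_sum. Qed.

Section AalphaMatrix.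
Variables (R : rcfType) (alpha : R) (k : nat) (e : rel 'I_k).
Hypothesis ge : simple_graph e.
Local Notation A := (A_alpha alpha e).
Local Notation b := (1 - alpha).

Lemma A_alphaE i j : A i j = alpha * ((i == j)%:R * (deg e i)%:R) + b * (e i j)%:R.
Proof. by rewrite !mxE. Qed.

Lemma trmx_A_alpha : A^T = A.
Proof.
apply/matrixP=> i j; rewrite mxE !A_alphaE (adj_sym ge) eq_sym.
by case: eqVneq => [->|] //; rewrite !mul0r.
Qed.

Lemma sum_delta (f : 'I_k -> R) i : \sum_j (i == j)%:R * f j = f i.
Proof.
rewrite (bigD1 i) //= eqxx mul1r big1 ?addr0 // => j ji.
by rewrite eq_sym (negPf ji) mul0r.
Qed.

Lemma mxtrace_A_alpha : \tr A = alpha * (\sum_i deg e i)%:R.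
Proof.
rewrite /mxtrace natr_sum mulr_sumr; apply: eq_bigr => i _.
by rewrite A_alphaE eqxx (adj_irr ge) mulr0 addr0 mul1r.
Qed.

Lemma A_alpha_sqE i j : (A *m A) i j =
  alpha ^+ 2 * ((i == j)%:R * (deg e i)%:R ^+ 2) +
  alpha * b * ((deg e i)%:R + (deg e j)%:R) * (e i j)%:R +
  b ^+ 2 * \sum_l (e i l)%:R * (e l j)%:R.
Proof.
rewrite mxE; under eq_bigr => l _ do rewrite !A_alphaE.
rewrite (eq_bigr (fun l =>
  (i == l)%:R * (alpha ^+ 2 * (deg e i)%:R * (deg e l)%:R * (l == j)%:R
     + alpha * b * (deg e i)%:R * (e l j)%:R) +
  (j == l)%:R * (alpha * b * (deg e l)%:R * (e i l)%:R) +
  b ^+ 2 * ((e i l)%:R * (e l j)%:R))); last first.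
  by move=> l _; rewrite (eq_sym j l); ring.
rewrite !big_split /= !sum_delta -mulr_sumr; congr (_ + _).
by case: eqVneq => [<-|_]; rewrite ?(adj_irr ge); ring.
Qed.

Lemma mxtrace2_A_alpha : \tr (A *m A) =
  alpha ^+ 2 * (\sum_i deg e i ^ 2)%:R + b ^+ 2 * (\sum_i deg e i)%:R.
Proof.
rewrite /mxtrace !natr_sum !mulr_sumr -big_split /=; apply: eq_bigr => i _.
rewrite A_alpha_sqE eqxx (adj_irr ge) degR natrX mulr0 addr0 mul1r -degR; congr (_ + _ * _).
rewrite degR; apply: eq_bigr => l _; rewrite (adj_sym ge l i).
by case: (e i l); rewrite ?mulr1 ?mulr0.
Qed.

Lemma mxtrace3_A_alpha : \tr (A *m A *m A) =
  alpha ^+ 3 * (\sum_i deg e i ^ 3)%:R +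
  3 * alpha * b ^+ 2 * (\sum_i deg e i ^ 2)%:R +
  b ^+ 3 * (\sum_i triwalks e i)%:R.
Proof.
pose w i j : R := \sum_l (e i l)%:R * (e l j)%:R.
have wii i : w i i = (deg e i)%:R.
  rewrite /w degR; apply: eq_bigr => l _; rewrite (adj_sym ge l i).
  by case: (e i l); rewrite ?mulr1 ?mulr0.
(* The coefficient 2 of the squared degree becomes 3 in the trace: summed over i, the neighbour
   degree sums also give the sum of squared degrees. *)
have E i : (A *m A *m A) i i = alpha ^+ 3 * (deg e i)%:R ^+ 3
    + 2 * alpha * b ^+ 2 * (deg e i)%:R ^+ 2
    + (alpha * b ^+ 2 * (\sum_j (deg e j)%:R * (e i j)%:R))
    + b ^+ 3 * \sum_j w i j * (e i j)%:R.
  rewrite mxE (eq_bigr (fun j =>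
    (i == j)%:R * (alpha ^+ 3 * (deg e i)%:R ^+ 2 * (deg e j)%:R
       + alpha * b ^+ 2 * w i j * (deg e j)%:R)
    + alpha * b ^+ 2 * (deg e i)%:R * (e i j)%:R
    + alpha * b ^+ 2 * ((deg e j)%:R * (e i j)%:R)
    + b ^+ 3 * (w i j * (e i j)%:R))); last first.
    move=> j _; rewrite A_alpha_sqE A_alphaE -/(w i j) (adj_sym ge j i) (eq_sym j i).
    case: eqVneq => [<-|_]; rewrite ?(adj_irr ge); move: (w _ _) => W.
      by rewrite !mulr0 !addr0 !mul1r; ring.
    by case: (e i j); rewrite ?(mulr0, mul0r, mulr1, mul1r, addr0, add0r); ring.
  rewrite !big_split /= sum_delta wii -!mulr_sumr -degR; ring.
rewrite /mxtrace (eq_bigr _ (fun i _ => E i)).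
rewrite !big_split /= -!mulr_sumr.
have -> : \sum_i \sum_j (deg e j)%:R * (e i j)%:R = \sum_i (deg e i)%:R ^+ 2 :> R.
  rewrite exchange_big /=; apply: eq_bigr => j _; rewrite -mulr_sumr expr2 {3}degR.
  by congr (_ * _); apply: eq_bigr => i _; rewrite (adj_sym ge).
have -> : \sum_i \sum_j w i j * (e i j)%:R = (\sum_i triwalks e i)%:R :> R.
  rewrite natr_sum; apply: eq_bigr => i _; rewrite /triwalks natr_sum.
  apply: eq_bigr => j _; rewrite natr_sum mulr_suml.
  apply: eq_bigr => l _; rewrite (adj_sym ge l j).
  by case: (e i j); case: (e i l); case: (e j l); rewrite /= ?mulr1 ?mulr0 ?mul0r.
rewrite !natr_sum; under [\sum_i (_ ^ 3)%:R]eq_bigr => i _ do rewrite natrX.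
under [\sum_i (_ ^ 2)%:R]eq_bigr => i _ do rewrite natrX.
ring.
Qed.

Definition nonadj i j := (i != j) && ~~ e i j.

Lemma nonadj_sym i j : nonadj i j = nonadj j i.
Proof. by rewrite /nonadj (adj_sym ge) eq_sym. Qed.

Lemma row_A_alphaE (x : 'rV_k) j :
  (x *m A) 0 j = alpha * (deg e j)%:R * x 0 j + b * \sum_i (e j i)%:R * x 0 i.
Proof.
rewrite mxE (eq_bigr (fun i => (j == i)%:R * (alpha * (deg e i)%:R * x 0 i)
   + b * ((e j i)%:R * x 0 i))); last first.
  by move=> i _; rewrite A_alphaE (eq_sym j i) (adj_sym ge i j); ring.
by rewrite big_split /= sum_delta -mulr_sumr.
Qed.

Lemma qform_A_alpha (x : 'rV_k) :
  qform A x = \sum_i \sum_j (e i j)%:R * (alpha * x 0 i ^+ 2 + b * (x 0 i * x 0 j)).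
Proof.
rewrite /qform mxE; apply: eq_bigr => j _; rewrite row_A_alphaE mxE.
rewrite mulrDl degR mulr_sumr !mulr_suml mulr_sumr mulr_suml -big_split /=.
by apply: eq_bigr => i _; ring.
Qed.

(* [A_alpha] of a graph and of its complement add up to [A_alpha] of the complete graph. *)
Lemma qform_A_alpha_compl (x : 'rV_k) :
  qform A x = (alpha * k%:R - 1) * sqnorm x + b * (\sum_i x 0 i) ^+ 2
   - 2^-1 * \sum_i \sum_j (nonadj i j)%:R *
       (b * (x 0 i + x 0 j) ^+ 2 + (alpha - b) * (x 0 i ^+ 2 + x 0 j ^+ 2)).
Proof.
pose f i j := alpha * x 0 i ^+ 2 + b * (x 0 i * x 0 j).
(* Nonadjacency is symmetric, so f may be symmetrized: f i j + f j i is the bracketed expression. *)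
have -> : \sum_i \sum_j (nonadj i j)%:R *
      (b * (x 0 i + x 0 j) ^+ 2 + (alpha - b) * (x 0 i ^+ 2 + x 0 j ^+ 2))
    = 2 * \sum_i \sum_j (nonadj i j)%:R * f i j.
  rewrite mulr_natl mulr2n [X in _ = _ + X]exchange_big /= -big_split /=; apply: eq_bigr => i _.
  rewrite -big_split /=; apply: eq_bigr => j _; rewrite (nonadj_sym j i) /f; ring.
rewrite mulKf ?pnatr_eq0 //; apply/eqP; rewrite eq_sym subr_eq eq_sym; apply/eqP.
rewrite qform_A_alpha -big_split /=.
have -> : \sum_i (\sum_j (e i j)%:R * f i j + \sum_j (nonadj i j)%:R * f i j) =
    \sum_i \sum_j (f i j - (i == j)%:R * f i j).
  apply: eq_bigr => i _; rewrite -big_split /=; apply: eq_bigr => j _.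
  rewrite /nonadj; case: eqVneq => [<-|_] /=; rewrite ?(adj_irr ge) ?mul1r ?mul0r ?subrr ?addr0 //.
  by case: (e i j); rewrite /= ?(mulr0, mul0r, mulr1, mul1r, addr0, add0r); ring.
have -> : \sum_i \sum_j (f i j - (i == j)%:R * f i j) =
    \sum_i ((alpha * k%:R - 1) * x 0 i ^+ 2 + b * (x 0 i * \sum_j x 0 j)).
  apply: eq_bigr => i _; rewrite sumrB sum_delta /f big_split /= sumr_const card_ord.
  by rewrite -!mulr_sumr -mulr_natr; ring.
by rewrite big_split /= -!mulr_sumr -mulr_suml expr2.
Qed.

Hypothesis alpha_gt : 1 / 2 < alpha.
Hypothesis alpha_lt : alpha < 1.

Lemma nonadj_term_ge0 (u v : R) :
  (alpha - b) * (u ^+ 2 + v ^+ 2) <= b * (u + v) ^+ 2 + (alpha - b) * (u ^+ 2 + v ^+ 2).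
Proof. by rewrite lerDr mulr_ge0 ?sqr_ge0 // subr_ge0 ltW. Qed.

Lemma alpha_b_gt0 : 0 < alpha - b.
Proof. have := alpha_gt; lra. Qed.

(** No nonadjacent pair meets [D], so the complement term vanishes and only a nonnegative multiple
    of the squared coordinate sum remains. *)
Lemma qform_dominating_ge (D : {set 'I_k}) (x : 'rV_k) :
  {in D, forall v, dominating e v} -> (forall i, i \notin D -> x 0 i = 0) ->
  (alpha * k%:R - 1) * sqnorm x <= qform A x.
Proof.
move=> domD xD; rewrite qform_A_alpha_compl [X in _ - _ * X]big1 => [|i _].
  by rewrite mulr0 subr0 lerDl mulr_ge0 ?sqr_ge0 // subr_ge0 ltW.
rewrite big1 // => j _; case: (boolP (nonadj i j)) => [|_]; last by rewrite mul0r.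
case/andP=> ij /negP nij.
have iD : i \notin D.
  by apply/negP=> /domD/forallP/(_ j); rewrite eq_sym ij.
have jD : j \notin D.
  by apply/negP=> /domD/forallP/(_ i); rewrite ij (adj_sym ge).
by rewrite !xD // addr0 expr0n /= addr0 !mulr0 addr0 mulr0.
Qed.

(** A nonadjacent pair containing i contributes at least a positive multiple of (alpha - b) x_i^2 to
    the subtracted sum. This is where alpha > 1/2 enters, as alpha - b = 2 alpha - 1. *)
Lemma qform_nondominating_lt (x : 'rV_k) : \sum_i x 0 i = 0 ->
  (exists2 i, ~~ dominating e i & x 0 i != 0) ->
  qform A x < (alpha * k%:R - 1) * sqnorm x.
Proof.
move=> x0 [i + xi]; rewrite negb_forall => /existsP[j]; rewrite negb_imply eq_sym => nij.
rewrite qform_A_alpha_compl x0 expr0n /= mulr0 addr0 ltrBlDr ltrDl mulr_gt0 ?invr_gt0 //.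
have t_ge0 u v : 0 <= (nonadj u v)%:R *
   (b * (x 0 u + x 0 v) ^+ 2 + (alpha - b) * (x 0 u ^+ 2 + x 0 v ^+ 2)).
  rewrite mulr_ge0 // (le_trans _ (nonadj_term_ge0 _ _)) //.
  by rewrite mulr_ge0 ?(ltW alpha_b_gt0) // addr_ge0 ?sqr_ge0.
rewrite (bigD1 i) //= ltr_pwDl //; last first.
  by apply: sumr_ge0 => u _; apply: sumr_ge0 => v _; apply: t_ge0.
rewrite (bigD1 j) //= ltr_pwDl //; last by apply: sumr_ge0 => v _; apply: t_ge0.
rewrite /nonadj nij mul1r (lt_le_trans _ (nonadj_term_ge0 _ _)) //.
by rewrite mulr_gt0 ?alpha_b_gt0 // ltr_pwDl ?sqr_ge0 // exprn_even_gt0.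
Qed.

End AalphaMatrix.

(** Inertia at alpha k - 1: vectors supported on [D] against vectors of sum zero that vanish at all
    but one dominating vertex of [e']. The sum condition remains even when [e'] has no dominating
    vertex, so the bound is the maximum of 1 and the number of dominating vertices. *)
Lemma cospectral_dominating (R : rcfType) (alpha : R) (k : nat) (e e' : rel 'I_k)
    (D : {set 'I_k}) :
  1 / 2 < alpha -> alpha < 1 -> simple_graph e -> simple_graph e' ->
  {in D, forall v, dominating e v} ->
  char_poly (A_alpha alpha e) = char_poly (A_alpha alpha e') ->
  (#|D| <= #|[set v | dominating e' v]|.-1.+1)%N.
Proof.
move=> al au ge ge' domD cosp; set D' := [set v | _].
(* One dominating vertex may be left out: a vector supported on a single vertex and of sum zero is
   zero. *)
pose t := behead (enum D').
pose L : 'M[R]_(k, 1 + size t) :=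
  row_mx (const_mx 1) (\matrix_(i, j) (tnth (in_tuple t) j == i)%:R).
have -> : #|D'|.-1.+1 = (1 + size t)%N by rewrite size_behead -cardE.
apply: (cospectral_inertia (trmx_A_alpha _ ge) (trmx_A_alpha _ ge') cosp
  (c := alpha * k%:R - 1) (U := rowsub (@enum_val _ (mem D)) 1%:M) (L := L)).
- apply/row_freeP; exists (rowsub (@enum_val _ (mem D)) 1%:M)^T.
  apply/matrixP=> i j; rewrite !mxE (bigD1 (enum_val i)) //= !mxE eqxx mul1r.
  rewrite big1 ?addr0 ?(inj_eq enum_val_inj) 1?eq_sym // => l li.
  by rewrite !mxE eq_sym (negPf li) mul0r.
- move=> y; apply: (qform_dominating_ge ge au domD) => i iD.
  rewrite mxE big1 // => j _; rewrite !mxE.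
  by case: eqP => [E|]; rewrite ?mulr0 //; rewrite -E enum_valP in iD.
- move=> x x0; rewrite mul_mx_row => xL.
  have s0 : x *m const_mx 1 = 0 :> 'rV_1 by have := congr1 lsubmx xL; rewrite row_mxKl linear0.
  have := congr1 rsubmx xL; rewrite row_mxKr linear0 => t0.
  have xs : \sum_i x 0 i = 0.
    have /rowP/(_ 0) := s0; rewrite [_ 0 0 in RHS]mxE => {2}<-; rewrite mxE.
    by apply: eq_bigr => i _; rewrite mxE mulr1.
  have xt v : v \in t -> x 0 v = 0.
    move=> vt; have it : (index v t < size t)%N by rewrite index_mem.
    have /rowP/(_ (Ordinal it)) := t0; rewrite !mxE.
    rewrite (bigD1 v) //= mxE (tnth_nth v) /= nth_index // eqxx mulr1 big1 ?addr0 //.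
    by move=> i iv; rewrite mxE (tnth_nth v) /= nth_index // eq_sym (negPf iv) mulr0.
  apply: qform_nondominating_lt => //.
  have /existsP[i /andP[di xi]] : [exists i, ~~ dominating e' i && (x 0 i != 0)].
    have [v1 _] := rV0Pn _ x0; apply: contraR x0; rewrite negb_exists => /forallP h.
    have xD v : v \notin D' -> x 0 v = 0.
      by rewrite inE => dv; have := h v; rewrite dv /= negbK => /eqP.
    (* [v0] is the dominating vertex left out of [t]. If there is none, x vanishes everywhere and
       any index serves. *)
    have [v0 hv0] : exists v0, forall v, v != v0 -> x 0 v = 0.
      case E : (enum D') => [|v0 t'].
        by exists v1 => w _; apply: xD; rewrite -mem_enum E.
      exists v0 => v vv0; case: (boolP (v \in D')) => [|/xD //].
      by rewrite -mem_enum E inE (negPf vv0) /= => vt; apply: xt; rewrite /t E.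
    apply/eqP/rowP=> v; rewrite [RHS]mxE.
    have [->|/hv0//] := eqVneq v v0.
    by move: xs; rewrite (bigD1 v0) //= big1 ?addr0.
  by exists i.
Qed.

(** * Eigenvectors along a path component *)

Fixpoint linrec (R : nzRingType) (tau p0 p1 : R) (i : nat) : R :=
  match i with
  | 0 => p0
  | 1 => p1
  | (j.+1 as i').+1 => tau * linrec tau p0 p1 i' - linrec tau p0 p1 j
  end.

Lemma linrecE (R : nzRingType) (tau p0 p1 : R) i :
  linrec tau p0 p1 i.+2 = tau * linrec tau p0 p1 i.+1 - linrec tau p0 p1 i.
Proof. by []. Qed.

Lemma linrec_unique (R : nzRingType) (tau : R) (g : nat -> R) (a : nat) :
  (forall i, (i < a)%N -> g i.+2 = tau * g i.+1 - g i) ->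
  forall i, (i <= a.+1)%N -> linrec tau (g 0) (g 1%N) i = g i.
Proof.
move=> gE; suff H i : (i <= a)%N ->
    linrec tau (g 0) (g 1%N) i = g i /\ linrec tau (g 0) (g 1%N) i.+1 = g i.+1.
  case=> [//|i] ia; by case: (H i ia).
elim: i => [//|i IHi] ia; have [h1 h2] := IHi (ltnW ia).
by split=> //; rewrite linrecE h1 h2 gE.
Qed.

(* Once the absolute values stop decreasing they grow, so two distinct centres of symmetry
   are impossible for a nonzero sequence. *)
Lemma linrec_two_symmetries (R : realFieldType) (tau p0 p1 : R) (a n : nat) :
  2 < tau -> (a < n)%N ->
  linrec tau p0 p1 a = p1 -> linrec tau p0 p1 a.+1 = p0 ->
  linrec tau p0 p1 n = p1 -> linrec tau p0 p1 n.+1 = p0 ->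
  p0 = 0 /\ p1 = 0.
Proof.
move=> tau2 an; set f := linrec tau p0 p1 => fa fa1 fn fn1.
have grow i : `|f i| <= `|f i.+1| -> (tau - 1) * `|f i.+1| <= `|f i.+2|.
  move=> h; rewrite /f linrecE -/f (le_trans _ (lerB_dist _ _)) //.
  by rewrite normrM gtr0_norm; lra.
have mono i : `|f i| <= `|f i.+1| -> `|f i.+1| <= `|f i.+2|.
  by move=> /grow; apply: le_trans; rewrite ler_peMl //; lra.
have monos i j : `|f i| <= `|f i.+1| ->
    `|f (i + j)%N| <= `|f (i + j).+1%N| /\ `|f i| <= `|f (i + j)%N|.
  move=> h; elim: j => [|j [h1 h2]]; first by rewrite addn0 lexx.
  rewrite addnS; split; [exact: (mono _ h1) | exact: le_trans h2 h1].
(* Otherwise the absolute values would grow from index 0 on, against f a = p1 and f (a+1) = p0. *)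
have p10 : `|p1| <= `|p0|.
  rewrite leNgt; apply/negP=> lt01.
  have [] := monos 0 a; first by rewrite /f /= ltW.
  by rewrite add0n fa fa1 leNgt lt01.
have ha : `|f a| <= `|f a.+1| by rewrite fa fa1.
(* Growth from a on compares index a+1, where the value is p0, with index n, where it is p1. *)
have := monos a.+1 (n - a.+1)%N (mono _ ha); rewrite subnKC // fa1 fn fn1 => -[_ p01].
have eqn : `|p0| = `|p1| by apply/eqP; rewrite eq_le p01 p10.
have [h1 _] := monos a (n - a.+1)%N ha.
have jn : (a + (n - a.+1)).+1 = n by lia.
(* At n the growth factor tau - 1 > 1 links two values of equal absolute value, which must then be
   zero. *)
have := grow _ h1; rewrite jn fn fn1 eqn => h2.
have : `|p1| = 0.
  apply/eqP; rewrite eq_le normr_ge0 andbT.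
  have : (tau - 2) * `|p1| <= 0 by lra.
  by rewrite pmulr_rle0 //; lra.
by move=> z; split; apply/eqP; rewrite -normr_eq0 ?eqn z.
Qed.

(* [e] is the join of the clique [D] with a graph having the path [s] as a connected component
   and all of whose other vertices have degree 2. *)
Record path_in_join (k : nat) (e : rel 'I_k) (D : {set 'I_k}) (s : seq 'I_k) : Prop :=
  PathInJoin {
    pj_dom : {in D, forall v, dominating e v};
    pj_uniq : uniq s;
    pj_disj : {in s, forall v, v \notin D};
    pj_adj : {in s, forall v w, w \notin D ->
      e v w = (w \in s) && (((index v s).+1 == index w s) || ((index w s).+1 == index v s))};
    pj_rest : forall v, v \notin D -> v \notin s -> deg e v = (#|D| + 2)%N }.

Section PathStructure.

(** * Degrees and neighbour sums in a join with a path component *)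

Variables (k : nat) (e : rel 'I_k) (D : {set 'I_k}) (s : seq 'I_k) (x0 : 'I_k).
Hypothesis ge : simple_graph e.
Hypothesis pj : path_in_join e D s.
Local Notation a := (size s).
Local Notation m := #|D|.
Local Notation p i := (nth x0 s i).

Lemma adj_dominating v w : v \in D -> e v w = (w != v).
Proof.
move=> /(pj_dom pj)/forallP/(_ w); case: eqVneq => [->|] //= _.
by rewrite (adj_irr ge).
Qed.

Lemma deg_dominating v : v \in D -> deg e v = k.-1.
Proof.
move=> vD; rewrite /deg (_ : [set j | e v j] = [set~ v]) ?cardsC1 ?card_ord //.
by apply/setP=> w; rewrite !inE adj_dominating.
Qed.

Lemma sum_adj_outside (R : comNzRingType) (f : 'I_k -> R) v : v \notin D ->
  \sum_w (e v w)%:R * f w = \sum_(w in D) f w + \sum_(w | w \notin D) (e v w)%:R * f w.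
Proof.
move=> vD; rewrite (bigID (mem D)) /=; congr (_ + _); apply: eq_bigr => w wD.
rewrite (adj_sym ge) adj_dominating // [v != w](_ : _ = true) ?mul1r //.
by apply: contraNneq vD => ->.
Qed.

Lemma sum_adj_path (R : comNzRingType) (f : 'I_k -> R) i : (i < a)%N ->
  \sum_(w | w \notin D) (e (p i) w)%:R * f w =
    (if (0 < i)%N then f (p i.-1) else 0) + (if (i.+1 < a)%N then f (p i.+1) else 0).
Proof.
move=> ia; have pis : p i \in s by rewrite mem_nth.
rewrite (eq_bigr (fun w => (w \in s)%:R *
    (((i.+1 == index w s) || ((index w s).+1 == i))%:R * f w))); last first.
  move=> w wD; rewrite (pj_adj pj) // index_uniq ?(pj_uniq pj) //.
  by case: (w \in s); rewrite ?mul1r ?mul0r.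
rewrite (bigID (mem s)) /= [X in _ + X]big1 ?addr0; last first.
  by move=> w /andP[_ /negPf->]; rewrite mul0r.
rewrite (eq_bigl (mem s)); last first.
  move=> w /=; case: (boolP (w \in s)) => [/(pj_disj pj)->//|]; by rewrite andbF.
rewrite -big_uniq ?(pj_uniq pj) //= (big_nth x0) big_mkord.
rewrite (eq_bigr (fun j : 'I_a => ((i.+1 == j) || (j.+1 == i))%:R * f (p j))); last first.
  by move=> j _; rewrite mem_nth // mul1r index_uniq ?(pj_uniq pj).
rewrite (eq_bigr (fun j : 'I_a => (i.+1 == j)%:R * f (p j) + (j.+1 == i)%:R * f (p j))); last first.
  move=> j _; rewrite -mulrDl; congr (_ * _).
  case: (i.+1 =P j) => [E|_] /=; last by rewrite add0r.
  by rewrite [j.+1 == i](_ : _ = false) ?addr0 //; apply/eqP; lia.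
rewrite big_split /= addrC; congr (_ + _).
  case: i ia pis => [|i] ia _ /=; first by rewrite big1 // => j _; rewrite mul0r.
  rewrite (bigD1 (Ordinal (ltnW ia))) //= eqxx mul1r big1 ?addr0 // => j ji.
  by rewrite eqSS [_ == _](_ : _ = false) ?mul0r //; apply: negPf; apply: contra ji.
case: ltnP => [h|h].
  rewrite (bigD1 (Ordinal h)) //= eqxx mul1r big1 ?addr0 // => j ji.
  by rewrite eq_sym [_ == _](_ : _ = false) ?mul0r //; apply: negPf; apply: contra ji.
rewrite big1 // => j _; rewrite [_ == _](_ : _ = false) ?mul0r //.
by apply/eqP; have := ltn_ord j; lia.
Qed.

Lemma deg_path i : (i < a)%N -> deg e (p i) = (m + ((0 < i) + (i.+1 < a)))%N.
Proof.
move=> ia; have pD : p i \notin D by apply: (pj_disj pj); rewrite mem_nth.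
have := sum_adj_outside (fun=> 1 : int) pD; rewrite sum_adj_path //.
rewrite (eq_bigr (fun w => (e (p i) w)%:R : int)); last by move=> w _; rewrite mulr1.
rewrite -degR sumr_const => E; apply/eqP; rewrite -(eqr_nat int) E !natrD.
by case: (0 < i)%N; case: (i.+1 < a)%N.
Qed.

Lemma deg_outside_le v : v \notin D -> (deg e v <= m + 2)%N.
Proof.
move=> vD; case: (boolP (v \in s)) => [vs|/(pj_rest pj vD) -> //].
rewrite -(nth_index x0 vs) deg_path ?index_mem // leq_add2l.
by case: (0 < _)%N; case: (_ < a)%N.
Qed.

(** Outside [D] only the two ends of the path have degree below m + 2, each by one. *)
Lemma deficient_sum (R : comNzRingType) (f : 'I_k -> R) : (2 <= a)%N ->
  \sum_(v | v \notin D) ((m + 2)%:R - (deg e v)%:R) * f v = f (p 0) + f (p a.-1).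
Proof.
move=> sz; rewrite (bigID (mem s)) /= [X in _ + X]big1 ?addr0; last first.
  by move=> v /andP[vD vs]; rewrite (pj_rest pj) // subrr mul0r.
rewrite (eq_bigl (mem s)); last first.
  move=> w /=; case: (boolP (w \in s)) => [/(pj_disj pj)->//|]; by rewrite andbF.
rewrite -big_uniq ?(pj_uniq pj) //= (big_nth x0) big_mkord.
rewrite (eq_bigr (fun j : 'I_a => (j == 0 :> nat)%:R * f (p j) + (j == a.-1 :> nat)%:R * f (p j))).
  have a0 : (0 < a)%N by lia.
  have a1 : (a.-1 < a)%N by lia.
  rewrite big_split /= (bigD1 (Ordinal a0)) //= mul1r big1 ?addr0; last first.
    by move=> j j0; rewrite [_ == _](_ : _ = false) ?mul0r //; apply: negPf; apply: contra j0.
  rewrite (bigD1 (Ordinal a1)) //= eqxx mul1r big1 ?addr0 // => j j0.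
  by rewrite [_ == _](_ : _ = false) ?mul0r //; apply: negPf; apply: contra j0.
move=> j _; rewrite -mulrDl deg_path //; congr (_ * _).
rewrite !natrD opprD addrACA subrr add0r.
have -> : (j == a.-1 :> nat) = ~~ (j.+1 < a)%N by have := ltn_ord j; lia.
have -> : (j == 0 :> nat) = ~~ (0 < j)%N by case: (nat_of_ord j).
by case: (0 < j)%N; case: (j.+1 < a)%N; rewrite /= ?mulr1n ?mulr0n; ring.
Qed.

End PathStructure.

(** * The eigenvalue equation on the clique, outside it, and along the path *)

Section PathEigenvector.
Variables (R : rcfType) (alpha : R) (k : nat) (e : rel 'I_k).
Variables (D : {set 'I_k}) (s : seq 'I_k) (x0 : 'I_k).
Hypotheses (ge : simple_graph e) (alpha_gt0 : 0 < alpha) (alpha_lt1 : alpha < 1).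
Hypothesis pj : path_in_join e D s.
Hypothesis sz : (2 <= size s)%N.
Local Notation b := (1 - alpha).
Local Notation a := (size s).
Local Notation m := #|D|.
Local Notation n := (k - #|D|)%N.
Local Notation p i := (nth x0 s i).
Variables (lam : R) (x : 'rV[R]_k).
Hypothesis xA : x *m A_alpha alpha e = lam *: x.
Hypothesis lam_gt1 : alpha * m%:R + 2 < lam.
Hypothesis lam_gt2 : alpha * k%:R - 1 < lam.
Hypothesis m_gt0 : (0 < m)%N.

Let sigma := \sum_(v in D) x 0 v.
Let S := \sum_(v | v \notin D) x 0 v.
(** A vertex outside [D] with two neighbours there has row sum alpha (m + 2) + 2 b = alpha m + 2
    over the columns outside [D]; [t] is the excess of [lam] over it. *)
Let t := lam - alpha * m%:R - 2.

Lemma eigen_eq v :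
  lam * x 0 v = alpha * (deg e v)%:R * x 0 v + b * \sum_w (e v w)%:R * x 0 w.
Proof. by rewrite -row_A_alphaE // xA mxE. Qed.

(** The diagonal entry is alpha (k - 1), and the sum over the neighbours is the total minus x_v;
    alpha + b = 1 merges the two terms in x_v. *)
Lemma eigen_dominating v : v \in D -> (lam - alpha * k%:R + 1) * x 0 v = b * (sigma + S).
Proof.
move=> vD; have k0 : (0 < k)%N by case: (k) v {vD} => [[]|].
have -> : sigma + S = \sum_w x 0 w by rewrite [RHS](bigID (mem D)).
have := eigen_eq v; rewrite (deg_dominating ge pj) //.
rewrite (eq_bigr (fun w => x 0 w - (v == w)%:R * x 0 w)).
  have kE : k%:R = k.-1%:R + 1 :> R by rewrite natr1 prednK.
  rewrite sumrB sum_delta kE => E.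
  by apply/eqP; rewrite -subr_eq0; apply/eqP; rewrite mulrDl mulrBl E; ring.
move=> w _; rewrite (adj_dominating ge pj) // eq_sym.
by case: (v == w); rewrite ?mul1r ?mul0r ?subrr ?subr0.
Qed.

Lemma eigen_sum_dominating : (lam - alpha * k%:R + 1) * sigma = m%:R * b * (sigma + S).
Proof.
rewrite mulr_sumr (eq_bigr _ (fun v vD => eigen_dominating vD)) sumr_const.
by rewrite -[LHS]mulr_natl mulrA.
Qed.

(** Exchanging the double sum over edges outside [D] gives x_v the coefficient alpha deg + b (deg -
    m) = deg - b m. This is alpha m + 2 minus the deficiency m + 2 - deg, which is supported on the
    ends of the path. *)
Lemma eigen_sum_outside : t * S = n%:R * b * sigma - (x 0 (p 0) + x 0 (p a.-1)).
Proof.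
have E : lam * S = \sum_(v | v \notin D) alpha * (deg e v)%:R * x 0 v
   + b * (n%:R * sigma + \sum_(v | v \notin D) ((deg e v)%:R - m%:R) * x 0 v).
  rewrite mulr_sumr (eq_bigr _ (fun v _ => eigen_eq v)) big_split /= -mulr_sumr.
  congr (_ + _ * _).
  rewrite (eq_bigr _ (fun v vD => sum_adj_outside ge pj (fun w => x 0 w) vD)) big_split /=.
  congr (_ + _).
    rewrite sumr_const -/sigma -[LHS]mulr_natl; congr (_%:R * _).
    by rewrite -[X in (X - _)%N]card_ord -(cardC (mem D)) addKn; apply: eq_card.
  rewrite exchange_big /=; apply: eq_bigr => w wD; rewrite -mulr_suml; congr (_ * _).
  have := sum_adj_outside ge pj (fun=> 1 : R) wD.
  rewrite (eq_bigr (fun v => (e w v)%:R)); last by move=> v _; rewrite mulr1.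
  rewrite -degR sumr_const => ->; rewrite addrC addKr.
  by apply: eq_bigr => v _; rewrite mulr1 (adj_sym ge).
rewrite -(deficient_sum x0 ge pj (fun v => x 0 v) sz) /t.
have split1 (c : R) : \sum_(v | v \notin D) (c - (deg e v)%:R) * x 0 v =
    c * S - \sum_(v | v \notin D) (deg e v)%:R * x 0 v.
  by rewrite mulr_sumr -sumrB; apply: eq_bigr => v _; rewrite mulrBl.
have split2 : \sum_(v | v \notin D) ((deg e v)%:R - m%:R) * x 0 v =
    \sum_(v | v \notin D) (deg e v)%:R * x 0 v - m%:R * S.
  by rewrite mulr_sumr -sumrB; apply: eq_bigr => v _; rewrite mulrBl.
have split3 : \sum_(v | v \notin D) alpha * (deg e v)%:R * x 0 v =
    alpha * \sum_(v | v \notin D) (deg e v)%:R * x 0 v.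
  by rewrite mulr_sumr; apply: eq_bigr => v _; rewrite mulrA.
move: E; rewrite split1 split2 split3 natrD; move: (\sum_(v | _) _ * _) => Q E.
by rewrite !mulrBl E; ring.
Qed.

(* Where [|x|] is largest outside [D], the eigenvalue equation would force [lam <= alpha m + 2]. *)
Lemma sigma_neq0 : x != 0 -> sigma != 0.
Proof.
apply: contraNneq => s0.
have p0D : p 0 \notin D by apply: (pj_disj pj); apply: mem_nth; apply: ltnW sz.
have out0 v : v \notin D -> x 0 v = 0.
  pose v1 := [arg max_(v > p 0 | v \notin D) `|x 0 v|]%O.
  have [v1D v1max] : v1 \notin D /\ forall w, w \notin D -> `|x 0 w| <= `|x 0 v1|.
    by rewrite /v1; case: arg_maxP => // i iD im; split=> // w wD; apply: im.
  have x1 : `|x 0 v1| = 0.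
    have := eigen_eq v1; rewrite (sum_adj_outside ge pj) // -/sigma s0 add0r => E.
    have E' : (lam - alpha * (deg e v1)%:R) * x 0 v1 =
        b * \sum_(w | w \notin D) (e v1 w)%:R * x 0 w by rewrite mulrBl E; ring.
    have dD : (deg e v1)%:R = m%:R + \sum_(w | w \notin D) (e v1 w)%:R :> R.
      have := sum_adj_outside ge pj (fun=> 1 : R) v1D; rewrite sumr_const.
      rewrite (eq_bigr (fun v => (e v1 v)%:R)); last by move=> w _; rewrite mulr1.
      by rewrite -degR => ->; congr (_ + _); apply: eq_bigr => w _; rewrite mulr1.
    have le_d : (deg e v1)%:R <= m%:R + 2 :> R by rewrite -natrD ler_nat (deg_outside_le x0 ge pj).
    have bnd : `|\sum_(w | w \notin D) (e v1 w)%:R * x 0 w| <= ((deg e v1)%:R - m%:R) * `|x 0 v1|.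
      rewrite dD addrC addKr.
      rewrite mulr_suml (le_trans (ler_norm_sum _ _ _)) //; apply: ler_sum => w wD.
      by rewrite normrM normr_nat ler_wpM2l // v1max.
    have := congr1 Num.norm E'; rewrite !normrM (gtr0_norm (_ : 0 < b)) ?subr_gt0 //.
    rewrite gtr0_norm; last first.
      by have := ler_wpM2l (ltW alpha_gt0) le_d; have := lam_gt1; have := alpha_lt1; lra.
    move=> E2; apply/eqP; rewrite eq_le normr_ge0 andbT.
    (* The bound reads (lam - alpha d) |x| <= b (d - m) |x| with d the degree; replacing d by m + 2
       only weakens it. *)
    have h : (lam - alpha * m%:R - 2) * `|x 0 v1| <= 0.
      have := ler_wpM2l (_ : 0 <= b) bnd; rewrite -E2 subr_ge0 ltW // => /(_ isT) h1.
      have : 0 <= (m%:R + 2 - (deg e v1)%:R) * `|x 0 v1| by rewrite mulr_ge0 // subr_ge0.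
      by move: h1; rewrite !mulrBl !mulrDl; lra.
    by move: h; rewrite pmulr_rle0 //; have := lam_gt1; lra.
  by move=> vD; apply/eqP; rewrite -normr_le0 -x1 v1max.
have S0 : S = 0 by rewrite /S big1.
apply/eqP/rowP=> v; rewrite [RHS]mxE.
case: (boolP (v \in D)) => [vD|/out0 //].
have := eigen_dominating vD; rewrite s0 S0 addr0 mulr0 => /eqP.
by rewrite mulf_eq0 => /orP[/eqP h|/eqP //]; have := lam_gt2; lra.
Qed.

(** At sigma = 1 the equation inside the path has the constant solution c = b / t, so u = c - x
    satisfies the homogeneous recurrence. [p1] is the sum of u over the two ends, expressed through
    [eigen_sum_outside] and [eigen_sum_dominating]; [p0] is the same sum for the fictitious vertices
    beyond the ends. Neither depends on the length of the path. *)
Lemma eigen_path_symmetric : sigma = 1 ->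
  let c := b / t in
  let p1 := 2 * c - (n%:R * b - t * ((lam - alpha * k%:R + 1) / (m%:R * b) - 1)) in
  let p0 := (2 * c - alpha * p1) / b in
  let f := linrec ((t + 2 * b) / b) p0 p1 in
  f a = p1 /\ f a.+1 = p0.
Proof.
move=> s1 c p1 p0 f.
have t0 : 0 < t by rewrite /t; have := lam_gt1; lra.
have b0 : 0 < b by rewrite subr_gt0.
have m0 : 0 < m%:R :> R by rewrite ltr0n.
have ES : (lam - alpha * k%:R + 1) / (m%:R * b) - 1 = S.
  have := eigen_sum_dominating; rewrite s1 mulr1 => ->.
  by field; rewrite !gt_eqF.
pose u i := c - x 0 (p i).
have Ep1 : p1 = u 0%N + u a.-1.
  by have := eigen_sum_outside; rewrite s1 mulr1 /p1 ES /u => ->; ring.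
(* [T] is u shifted by one, with a fictitious vertex at 0 and at a + 1. Its value makes the equation
   at an end, where the degree is m + 1, look like one in the interior: b x_(-1) + alpha x_0 = 0. *)
pose T i := if i is j.+1 then (if (j < a)%N then u j else (c - alpha * u a.-1) / b)
            else (c - alpha * u 0%N) / b.
pose tau := (t + 2 * b) / b.
have Trec i : (i < a)%N -> T i.+2 = tau * T i.+1 - T i.
  move=> ia; have pD : p i \notin D by apply: (pj_disj pj); rewrite mem_nth.
  have := eigen_eq (p i); rewrite (sum_adj_outside ge pj) // -/sigma s1.
  rewrite (sum_adj_path x0 pj) // (deg_path x0 ge pj) //.
  have xu j : x 0 (p j) = c - u j by rewrite /u; ring.
  have ct : c * t = b by rewrite /c; field; rewrite gt_eqF.
  have lamE : lam = t + alpha * m%:R + 2 by rewrite /t; ring.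
  (* The eigenvalue equation L = Q and c t = b enter as vanishing corrections, so that each case
     below is a polynomial or rational identity. *)
  have scale (L Q v w z : R) : L = Q -> b * v = z + (L - Q) + (b - c * t) ->
      b * w = z -> v = w.
    move=> -> + wz; rewrite subrr ct subrr !addr0 -wz; apply: mulfI.
    by rewrite gt_eqF.
  have b_neq0 : b != 0 by rewrite gt_eqF.
  rewrite lamE /T ia !natrD; case: i ia pD => [|i] ia pD /=.
    rewrite sz !xu /= => E.
    apply: (scale _ _ _ _ ((t + 2 * b) * u 0%N - c + alpha * u 0%N) E); first by ring.
    by rewrite /tau; field.
  rewrite (ltnW ia) !xu; case: ltnP => h /= E.
    apply: (scale _ _ _ _ ((t + 2 * b) * u i.+1 - b * u i) E); first by ring.
    by rewrite /tau; field.
  have -> : a.-1 = i.+1 by lia.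
  apply: (scale _ _ _ _ ((t + 2 * b) * u i.+1 - b * u i) E); last by rewrite /tau; field.
  by field.
(* Reversal of the path preserves the recurrence; the symmetrized sequence has known initial values
   although the individual end values are unknown. *)
pose g i := T i + T (a.+1 - i)%N.
have a_gt0 : (0 < a)%N := ltnW sz.
have Ta : T a = u a.-1 by rewrite /T; case: (a) a_gt0 => [//|a'] _; rewrite ltnSn.
have g0 : g 0%N = p0.
  by rewrite /g subn0 /= ltnn /p0 Ep1; field; rewrite gt_eqF.
have g1 : g 1%N = p1 by rewrite /g subn1 Ta /= a_gt0 Ep1.
have grec i : (i < a)%N -> g i.+2 = tau * g i.+1 - g i.
  move=> ia; rewrite /g; pose j := (a - i.+1)%N.
  have ja : (j < a)%N by rewrite /j; lia.
  have -> : (a.+1 - i = j.+2)%N by rewrite /j; lia.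
  have -> : (a.+1 - i.+1 = j.+1)%N by rewrite /j; lia.
  have -> : (a.+1 - i.+2 = j)%N by rewrite /j; lia.
  by rewrite Trec // (Trec j) //; ring.
have fg i : (i <= a.+1)%N -> f i = g i by rewrite /f -g0 -g1; apply: linrec_unique.
split; rewrite fg //.
  by rewrite -g1 /g subn1 subSnn addrC.
by rewrite -g0 /g subnn subn0 addrC.
Qed.

End PathEigenvector.

(** * Triangles and degrees *)

Section Triwalks.
Local Open Scope nat_scope.
Variables (k : nat) (e : rel 'I_k).
Hypothesis ge : simple_graph e.

Lemma sum_deg_pairs : \sum_v deg e v = \sum_j \sum_l e j l.
Proof. by apply: eq_bigr => j _; rewrite deg_sum. Qed.

Lemma sum_row_indicator v : \sum_j \sum_l (j == v) * e j l = deg e v.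
Proof.
rewrite (bigD1 v) //= eqxx [X in _ + X]big1 ?addn0 => [|j /negPf jv]; last first.
  by rewrite big1 // => l _; rewrite jv.
by rewrite deg_sum; apply: eq_bigr => l _; rewrite mul1n.
Qed.

Lemma sum_col_indicator v : \sum_j \sum_l (l == v) * e j l = deg e v.
Proof.
rewrite exchange_big /= -[RHS]sum_row_indicator; apply: eq_bigr => j _.
by apply: eq_bigr => l _; rewrite (adj_sym ge).
Qed.

(** Among the ordered pairs of distinct neighbours of v, only the adjacent ones are counted. *)
Lemma triwalks_le_deg v : triwalks e v <= deg e v * (deg e v).-1.
Proof.
rewrite {1}deg_sum big_distrl /=; apply: leq_sum => j _.
case: (boolP (e v j)) => vj; last by rewrite big1 ?mul0n // => l _.
have -> : (deg e v).-1 = \sum_(l | l != j) e v l.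
  by rewrite deg_sum (bigD1 j) //= vj.
rewrite mul1n (bigD1 j) //= (adj_irr ge) add0n.
by apply: leq_sum => l _; case: (e j l); case: (e v l).
Qed.

(** The ordered edges between neighbours of v are disjoint from the 2 deg v ordered edges at v. *)
Lemma triwalks_le_edges v : triwalks e v + 2 * deg e v <= \sum_w deg e w.
Proof.
rewrite sum_deg_pairs mul2n -addnn -{1}sum_row_indicator -sum_col_indicator.
rewrite -!big_split /=; apply: leq_sum => j _; rewrite -!big_split /=.
apply: leq_sum => l _.
case: (eqVneq j v) => [->|jv]; case: (eqVneq l v) => [->|lv]; rewrite ?(adj_irr ge) //=.
- by case: (e v l).
- by rewrite !andbF /=; case: (e j v).
- by case: (e v j); case: (e j l); case: (e v l).
Qed.

(** Edges at a nonneighbour w join no two neighbours of v and do not end at v, so they are lost as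
    well. *)
Lemma triwalks_le_edges2 v w : w != v -> ~~ e v w ->
  triwalks e v + 2 * deg e v + 2 * deg e w <= \sum_u deg e u.
Proof.
move=> wv nvw; have nwv : ~~ e w v by rewrite (adj_sym ge).
rewrite sum_deg_pairs !mul2n -!addnn -{1}(sum_row_indicator v) -(sum_col_indicator v).
rewrite -{1}(sum_row_indicator w) -(sum_col_indicator w).
rewrite -!big_split /=; apply: leq_sum => j _; rewrite -!big_split /=.
apply: leq_sum => l _; have vw : (v == w) = false by rewrite eq_sym (negPf wv).
case: (boolP (e j l)) => ejl; last by rewrite !muln0 andbF.
have neq x y : e x y -> (x == y) = false.
  by move=> exy; apply: contraTF exy => /eqP ->; rewrite (adj_irr ge).
have [jv|_] := eqVneq j v.
  rewrite jv in ejl *; rewrite (adj_irr ge) vw eq_sym (neq _ _ ejl).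
  by rewrite [l == w](_ : _ = false) //; apply: contraNF nvw => /eqP <-.
have [lv|_] := eqVneq l v.
  rewrite lv in ejl *; rewrite (adj_irr ge) vw !andbF.
  by rewrite [j == w](_ : _ = false) //; apply: contraNF nwv => /eqP <-.
have [jw|_] := eqVneq j w.
  by rewrite jw in ejl *; rewrite (negPf nvw) eq_sym (neq _ _ ejl).
by have [->|_] := eqVneq l w; rewrite ?(negPf nvw) ?andbF //=; case: (_ && _).
Qed.

Lemma triwalks_dominating v : dominating e v ->
  triwalks e v + 2 * deg e v = \sum_w deg e w.
Proof.
move=> /forallP dv; rewrite sum_deg_pairs mul2n -addnn -{1}sum_row_indicator -sum_col_indicator.
rewrite -!big_split /=; apply: eq_bigr => j _; rewrite -!big_split /=.
apply: eq_bigr => l _.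
case: (eqVneq j v) => [->|jv]; case: (eqVneq l v) => [->|lv]; rewrite ?(adj_irr ge) //=.
- by case: (e v l).
- by rewrite !andbF /=; case: (e j v).
- have := dv j; have := dv l; rewrite jv lv /= => -> ->.
  by case: (e j l).
Qed.

(** Every edge at v other than the one to c closes a triangle with c, counted twice. *)
Lemma triwalks_ge v c : dominating e c -> v != c -> 2 * (deg e v).-1 <= triwalks e v.
Proof.
move=> /forallP dc vc; have evc : e v c by have := dc v; rewrite vc (adj_sym ge).
have -> : (deg e v).-1 = \sum_(l | l != c) e v l by rewrite deg_sum (bigD1 c) //= evc.
rewrite mul2n -addnn /triwalks [X in _ <= X](bigD1 c) //=; apply: leq_add.
  rewrite [X in _ <= X](bigD1 c) //= (adj_irr ge) andbF add0n.
  by apply: leq_sum => l lc; have := dc l; rewrite lc evc /= => ->.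
apply: leq_sum => j jc; rewrite (bigD1 c) //= evc (adj_sym ge j c).
by have := dc j; rewrite jc /= andbT => ->; rewrite andbT; case: (e v j).
Qed.

Lemma nondominating_witness v : ~~ dominating e v -> exists2 w, w != v & ~~ e v w.
Proof.
by rewrite negb_forall => /existsP[w]; rewrite negb_imply => /andP[? ?]; exists w.
Qed.

Lemma deg_nondominating v : ~~ dominating e v -> deg e v + 2 <= k.
Proof.
case/nondominating_witness=> w wv nvw.
have c2 : #|[set v; w]| = 2 by rewrite cards2 eq_sym wv.
have := cardsC [set v; w]; rewrite c2 card_ord => kE; rewrite -[X in _ <= X]kE addnC leq_add2l.
apply: subset_leq_card; apply/subsetP=> u; rewrite !inE negb_or => vu.
by apply/andP; split; apply: contraTneq vu => ->; rewrite ?(adj_irr ge).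
Qed.

Lemma sum_deg_by_value (n : nat) (F : nat -> nat) : (forall v, deg e v < n) ->
  \sum_v F (deg e v) = \sum_(d < n) #|[set v | deg e v == d]| * F d.
Proof.
move=> dn; pose od v : 'I_n := Ordinal (dn v).
rewrite (partition_big od predT) //=; apply: eq_bigr => d _.
rewrite (eq_bigr (fun=> F d)); last by move=> v /eqP <-.
by rewrite sum_nat_const; congr (_ * _); apply: eq_card => v; rewrite [RHS]inE.
Qed.

End Triwalks.

Lemma Posz_sum (I : finType) (f : I -> nat) : (\sum_i f i)%N%:Z = \sum_i (f i)%:Z.
Proof. exact: (big_morph Posz PoszD). Qed.

(* The fan [K_1 \/ P_n] has degree sum [4n - 2], sum of squares [n^2 + 9n - 10], sum of cubes
   [n^3 + 27n - 38] and [6(n - 1)] closed 3-walks. *)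
Lemma no_dominating_bounds (n : nat) (e : rel 'I_n.+1) : (2 <= n)%N -> simple_graph e ->
  (forall v, ~~ dominating e v) ->
  (\sum_v deg e v + 2 = 4 * n)%N -> (\sum_v deg e v ^ 2 + 10 = n ^ 2 + 9 * n)%N ->
  (\sum_v deg e v ^ 3 + 38 < n ^ 3 + 27 * n)%N /\
  (\sum_v triwalks e v + \sum_v deg e v ^ 3 + 44 <= n ^ 3 + 33 * n)%N.
Proof.
move=> n2 ge nd s1 s2.
have dlt v : (deg e v < n)%N by have := deg_nondominating ge (nd v); lia.
(* The degree sum 4n - 2 is at most (n + 1)(n - 1). *)
have n4 : (4 <= n)%N.
  have : (\sum_v deg e v <= \sum_(v < n.+1) n.-1)%N.
    by apply: leq_sum => v _; have := dlt v; lia.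
  rewrite sum_nat_const card_ord; nia.
pose d v : int := (deg e v)%:Z; pose t v : int := (triwalks e v)%:Z.
have S0 : \sum_(v < n.+1) (1 : int) = n%:Z + 1 by rewrite sumr_const card_ord; lia.
have S1 : \sum_v d v = 4 * n%:Z - 2 by rewrite -Posz_sum; lia.
have S2 : \sum_v d v ^+ 2 = n%:Z ^+ 2 + 9 * n%:Z - 10.
  rewrite (eq_bigr (fun v => (deg e v ^ 2)%N%:Z)); last by move=> v _; rewrite /d; lia.
  rewrite -Posz_sum; lia.
have S3 : \sum_v d v ^+ 3 = (\sum_v deg e v ^ 3)%N%:Z.
  by rewrite Posz_sum; apply: eq_bigr => v _; rewrite /d; lia.
have dn v : 0 <= d v <= n%:Z - 1 by have := dlt v; rewrite /d; lia.
have q0 v : 0 <= d v ^+ 2 - 5 * d v + 6.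
  have [h|h] := leP (d v) 2; nia.
have lin (A B C : int) :
    \sum_v (A * d v ^+ 2 + B * d v + C * 1) =
    A * (n%:Z ^+ 2 + 9 * n%:Z - 10) + B * (4 * n%:Z - 2) + C * (n%:Z + 1).
  by rewrite !big_split /= -!mulr_sumr S0 S1 S2.
have part1 : \sum_v d v ^+ 3 < n%:Z ^+ 3 + 27 * n%:Z - 38.
  pose N : int := n%:Z.
  (* Termwise this is (N - 1 - d)(d - 2)(d - 3) >= 0, where 2 and 3 are the path degrees in the
     fan. *)
  have : \sum_v d v ^+ 3 <= \sum_v ((5 + (N - 1)) * d v ^+ 2 + (-6 - 5 * (N - 1)) * d v
      + (6 * (N - 1)) * 1).
    apply: ler_sum => v _; have [h1 h2] := andP (dn v); have := q0 v.
    rewrite /N; nia.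
  rewrite lin /N; nia.
split; first by move: part1; rewrite S3; lia.
have tle1 v : t v <= d v ^+ 2 - d v.
  by have := triwalks_le_deg ge v; rewrite /t /d; case: (deg e v) => [|j] /=; nia.
have tle2 v : t v + 2 * d v <= 4 * n%:Z - 2.
  by have := triwalks_le_edges ge v; rewrite /t /d; lia.
have [n7|n7] := leqP 7 n.
  set N : int := n%:Z in dn S0 S1 S2 lin part1 tle2.
  have N7 : 7 <= N by rewrite /N; lia.
  (* The majorant of t + d^3 is 5 d^2 - 2 d - 6 + K / (N - 3) (d - 2)(d - 3). Its first part agrees
     with d^3 + d^2 - d at d = 2, 3, the difference being (d + 1)(d - 2)(d - 3). [K] makes its total
     exactly the required bound. For d <= N - 2 the condition (N - 3)(d + 1) <= K follows from N >=
     7; at d = N - 1 the edge bound t <= 2 N is used. *)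
  pose K := N ^+ 2 - 3 * N - 4.
  have : \sum_v (N - 3) * (t v + d v ^+ 3) <= \sum_v ((5 * (N - 3) + K) * d v ^+ 2
      + (- 2 * (N - 3) - 5 * K) * d v + (- 6 * (N - 3) + 6 * K) * 1).
    apply: ler_sum => v _; have /andP[d0 dN] := dn v.
    move: (tle1 v) (tle2 v) (q0 v) d0 dN; move: (d v) (t v) => y z h1 h2 h3 h4 h5.
    have [h6|h6] := leP y (N - 2).
      have g1 : 0 <= (N - 3) * (y ^+ 2 - y - z) by rewrite mulr_ge0 //; lia.
      have g2 : 0 <= (N - 3) * (N - 2 - y) by rewrite mulr_ge0 //; lia.
      have g3 : 0 <= (K - (N - 3) * (y + 1)) * (y ^+ 2 - 5 * y + 6).
        by rewrite mulr_ge0 // /K; lia.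
      by move: g1 g3; rewrite /K; lia.
    have yE : y = N - 1 by lia.
    have g1 : 0 <= (N - 3) * (2 * N - z) by rewrite mulr_ge0 //; lia.
    have g2 : 0 <= (N - 3) * ((N - 3) * (N - 6)) by rewrite !mulr_ge0 //; lia.
    by move: g1 g2; rewrite /K yE; lia.
  rewrite lin -mulr_sumr big_split /= S3 -Posz_sum.
  rewrite (_ : _ + _ + _ = (N - 3) * (N ^+ 3 + 33 * N - 44)); last by rewrite /K; ring.
  have N3 : 0 < N - 3 by lia.
  rewrite ler_pM2l // /N; move: (\sum_v triwalks e v)%N (\sum_v deg e v ^ 3)%N => X Y h; clear -h.
  have : n%:Z ^+ 3 = (n ^ 3)%N by lia.
  lia.
(* For n at most 6 the claim becomes a linear integer problem in the numbers [C j] of vertices of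
   degree j. *)
pose C j := #|[set v | deg e v == j]|.
have byv (F : nat -> nat) : (\sum_v F (deg e v) = \sum_(0 <= j < n) C j * F j)%N.
  by rewrite big_mkord -(sum_deg_by_value F dlt).
have c0 : (n.+1 = \sum_(0 <= j < n) C j * 1)%N by rewrite -byv sum1_card card_ord.
have bound (F : nat -> nat) : (forall v, triwalks e v <= F (deg e v))%N ->
    (\sum_v triwalks e v + \sum_v deg e v ^ 3 <= \sum_(0 <= j < n) C j * (F j + j ^ 3))%N.
  move=> hF; rewrite -byv -big_split /=.
  by apply: leq_sum => v _; rewrite leq_add2r.
have isol v : deg e v = 0%N -> (0 < C 0%N)%N.
  by move=> dv; rewrite card_gt0; apply/set0Pn; exists v; rewrite inE dv.
have c1 := byv id; have c2 := byv (fun j => j ^ 2)%N.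
rewrite c1 in s1; rewrite c2 in s2.
set X := (\sum_v triwalks e v + \sum_v deg e v ^ 3)%N in bound *.
have [n6|n6] := eqVneq n 6%N.
  (* At the top degree 5 the edge bound gives 22 - 10 = 12. *)
  pose F j := (if j == 5 then 12 else j * j.-1)%N.
  have /(bound F) : forall v, (triwalks e v <= F (deg e v))%N.
    move=> v; have := tle2 v; have := triwalks_le_deg ge v; rewrite /t /d /F.
    by case: eqP => [->|_]; lia.
  rewrite /F; clearbody X C; move: c0 s1 s2; rewrite n6 !big_nat_recr //= !big_geq //; lia.
have [n5|n5] := eqVneq n 5%N.
  have c00 : C 0%N = 0%N.
    clearbody C; move: c0 s1 s2; rewrite n5 !big_nat_recr //= !big_geq //; lia.
  (* At the top degree 4 the edge bound 18 - 8 = 10 drops by 2 more, because a nonneighbour is not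
     isolated. *)
  pose F j := (if j == 4 then 8 else j * j.-1)%N.
  have /(bound F) : forall v, (triwalks e v <= F (deg e v))%N.
    move=> v; rewrite /F; case: eqP => [dv|_]; last exact: triwalks_le_deg.
    have [w wv nvw] := nondominating_witness (nd v).
    have := triwalks_le_edges2 ge wv nvw; have := @isol w; rewrite c00 c1; lia.
  rewrite /F; clearbody X C; move: c0 c00 s1 s2; rewrite n5 !big_nat_recr //= !big_geq //; lia.
have nE : n = 4%N by lia.
(* Five degrees at most 3 with sum 14 are 3, 3, 3, 3, 2, whose squares sum to 40 and not 42. *)
exfalso; clearbody C; move: c0 s1 s2.
by rewrite nE !big_nat_recr //= !big_geq //; lia.
Qed.

(** * Joins of a clique and a path *)

Section JoinKP.
Local Open Scope nat_scope.
Variables (m n : nat).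
Local Notation e := (join_KP_rel m n).

Lemma join_KP_simple : simple_graph e.
Proof.
split=> [x y|x]; rewrite /join_KP_rel ?eqxx // eq_sym; congr (_ && _).
by rewrite orbCA; congr [|| _, _ | _]; rewrite orbC.
Qed.

Definition KP_clique : {set 'I_(m + n)} := [set i : 'I_(m + n) | i < m].
Definition KP_path : seq 'I_(m + n) := [seq rshift m i | i <- enum 'I_n].

Lemma card_KP_clique : #|KP_clique| = m.
Proof.
have -> : KP_clique = [set lshift n i | i in 'I_m].
  apply/setP=> i; rewrite inE; apply/idP/imsetP => [im|[j _ ->]]; last by rewrite /= ltn_ord.
  by exists (Ordinal im) => //; apply: val_inj.
by rewrite card_imset ?card_ord //; apply: lshift_inj.
Qed.

Lemma size_KP_path : size KP_path = n.
Proof. by rewrite size_map size_enum_ord. Qed.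

Lemma KP_outside v : v \notin KP_clique -> exists i : 'I_n, v = rshift m i.
Proof.
rewrite inE -leqNgt => mv; have lt : v - m < n by have := ltn_ord v; lia.
by exists (Ordinal lt); apply: val_inj; rewrite /= subnKC.
Qed.

Lemma KP_path_outside v : (v \in KP_path) = (v \notin KP_clique).
Proof.
apply/mapP/idP => [[i _ ->]|/KP_outside[i ->]].
  by rewrite inE /= -leqNgt leq_addr.
by exists i; rewrite ?mem_enum.
Qed.

Lemma index_KP_path (i : 'I_n) : index (rshift m i) KP_path = i.
Proof. by rewrite index_map ?index_enum_ord //; apply: rshift_inj. Qed.

Lemma path_in_join_KP : path_in_join e KP_clique KP_path.
Proof.
split.
- move=> v; rewrite inE => vm; apply/forallP=> j; apply/implyP=> jv.
  by rewrite /join_KP_rel eq_sym jv vm.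
- by rewrite map_inj_uniq ?enum_uniq //; apply: rshift_inj.
- by move=> v; rewrite KP_path_outside.
- move=> v vs w wD; rewrite KP_path_outside wD /=.
  move: vs; rewrite KP_path_outside => /KP_outside[i ->].
  have [j ->] := KP_outside wD; rewrite !index_KP_path /join_KP_rel -val_eqE /=.
  by lia.
- by move=> v vD; rewrite KP_path_outside vD.
Qed.

End JoinKP.

(** * Extracting the path component and identifying the join *)

Lemma exists_longest_path (T : finType) (r : rel T) (p : T) :
  exists s : seq T, [/\ path r p s, uniq (p :: s) &
    forall w, r (last p s) w -> w \in p :: s].
Proof.
pose P l := [exists s : l.-tuple T, path r p s && uniq (p :: s)].
have exP : exists l, P l by exists 0%N; apply/existsP; exists [tuple].
have ubP l : P l -> (l <= #|T|)%N.
  case/existsP=> s /andP[_ /card_uniqP us]; rewrite -[l](size_tuple s).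
  by rewrite (leq_trans (leqnSn _)) // -[X in (X <= _)%N]us max_card.
case: (ex_maxnP exP ubP) => l /existsP[s /andP[ps us]] lmax.
exists s; split=> // w rw; apply/negPn/negP=> ws.
have : P l.+1.
  apply/existsP; exists [tuple of rcons s w]; apply/andP; split.
    by rewrite /= rcons_path ps.
  by rewrite -rcons_cons rcons_uniq ws.
by move/lmax; rewrite ltnn.
Qed.

(** Take a longest path outside [D] from the degree-one vertex [p]. Degrees at most 2 there leave no
    edge from the path to the rest, so its far end is the second and last vertex of degree one. *)
Lemma path_component (k : nat) (e : rel 'I_k) (D : {set 'I_k}) (p : 'I_k) :
  simple_graph e -> {in D, forall v, dominating e v} ->
  (forall v, v \notin D -> deg e v = (#|D| + 1)%N \/ deg e v = (#|D| + 2)%N) ->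
  #|[set v | (v \notin D) && (deg e v == #|D| + 1)%N]| = 2%N ->
  p \notin D -> deg e p = (#|D| + 1)%N ->
  exists2 s, path_in_join e D s & (2 <= size s)%N.
Proof.
move=> ge domD dg two pD dp.
pose r : rel 'I_k := fun x y => [&& e x y, x \notin D & y \notin D].
have rsym x y : r x y = r y x by rewrite /r (adj_sym ge) (andbC (x \notin D)).
have rirr x : r x x = false by rewrite /r (adj_irr ge).
pose N v := [set w | r v w].
have cN v : v \notin D -> deg e v = (#|D| + #|N v|)%N.
  move=> vD; rewrite /deg -(cardsID D [set j | e v j]).
  congr addn; apply: eq_card => w; rewrite !inE.
    case: (boolP (w \in D)) => [wD|]; last by rewrite andbF.
    rewrite andbT (adj_sym ge); have /forallP/(_ v) := domD _ wD.
    by rewrite [v != w](_ : _ = true) //; apply: contraNneq vD => ->.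
  by rewrite /r vD andbC.
have Np : #|N p| = 1%N by have := cN _ pD; lia.
have N2 v : v \notin D -> (#|N v| <= 2)%N by move=> vD; have := cN _ vD; have := dg _ vD; lia.
have [s [ps us maxs]] := exists_longest_path r p.
have sz : (0 < size s)%N.
  case: s ps us maxs => // _ _ maxs; have /card_gt0P[w] : (0 < #|N p|)%N by rewrite Np.
  by rewrite inE => rpw; have := maxs _ rpw; rewrite inE => /eqP E; rewrite E rirr in rpw.
pose S := p :: s; pose a := size S.
have a2 : (2 <= a)%N by rewrite /a /=.
have a1 : (a.-1 < a)%N by lia.
have rS i : (i.+1 < a)%N -> r (nth p S i) (nth p S i.+1).
  by move=> ia; apply: (pathP p ps).
have memS j : (j < a)%N -> nth p S j \in S by move=> ja; apply: mem_nth.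
have SD v : v \in S -> v \notin D.
  move=> vS; rewrite -(nth_index p vS); have : (index v S < a)%N by rewrite index_mem.
  case: (index v S) => [|i] ia; first by [].
  by have /and3P[] := rS _ ia.
have uS i j : (i < a)%N -> (j < a)%N -> (nth p S i == nth p S j) = (i == j).
  by move=> ia ja; apply: nth_uniq.
have N0 w : r p w = (w == nth p S 1%N).
  have sub : [set nth p S 1%N] \subset N p by rewrite sub1set inE; apply: (rS 0%N).
  have /eqP/setP/(_ w) : [set nth p S 1%N] == N p.
    by rewrite eqEcard sub cards1 Np.
  by rewrite !inE => <-.
have Nint i w : (0 < i)%N -> (i.+1 < a)%N ->
    r (nth p S i) w = (w == nth p S i.-1) || (w == nth p S i.+1).
  move=> i0 ia; have iD : nth p S i \notin D by apply: SD; rewrite mem_nth // ltnW.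
  have sub : [set nth p S i.-1; nth p S i.+1] \subset N (nth p S i).
    apply/subsetP=> u; rewrite !inE => /orP[/eqP->|/eqP->]; last exact: rS.
    by rewrite rsym; have := @rS i.-1; rewrite prednK //; apply; apply: ltnW.
  have /eqP/setP/(_ w) : [set nth p S i.-1; nth p S i.+1] == N (nth p S i).
    rewrite eqEcard sub cards2 uS //; last by lia.
    by rewrite [i.-1 == i.+1](_ : _ = false) ?N2 //; apply/eqP; lia.
  by rewrite !inE => <-.
have lastS : nth p S a.-1 = last p s by rewrite /a /= -[LHS]/(nth p (p :: s) (size s)) nth_last.
(* By maximality a neighbour of the last vertex lies on the path; the neighbours of all earlier
   vertices are known, so it is the predecessor. *)
have Nlast w : r (nth p S a.-1) w = (w == nth p S a.-2).
  apply/idP/eqP=> [rw|->]; last first.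
    by rewrite rsym; have := @rS a.-2; rewrite (_ : a.-2.+1 = a.-1); [apply|]; lia.
  have wS : w \in S by apply: maxs; rewrite -lastS.
  have iw : (index w S < a)%N by rewrite index_mem.
  move: rw; rewrite rsym -(nth_index p wS); move: (index w S) iw => j ja.
  have [j0|j0] := posnP j.
    rewrite j0 [nth p S 0%N]/= N0 uS //.
    by move=> /eqP h; rewrite (_ : a.-2 = 0%N) //; lia.
  have [jl|jl] := ltnP j.+1 a; last first.
    by rewrite (_ : j = a.-1) ?rirr //; lia.
  have j1 : (j.-1 < a)%N by lia.
  by rewrite Nint // !uS // => /orP[] /eqP h; congr (nth p S _); lia.
have adjS i w : (i < a)%N -> r (nth p S i) w =
    (w \in S) && ((i.+1 == index w S) || ((index w S).+1 == i)).
  move=> ia; case: (boolP (w \in S)) => [wS|wS]; rewrite ?andTb; last first.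
    apply/negP; have [i0|i0] := posnP i.
      by rewrite i0 [nth p S 0%N]/= N0 => /eqP wE; move: wS; rewrite wE memS.
    have [il|il] := ltnP i.+1 a.
      by rewrite Nint // => /orP[] /eqP wE; move: wS; rewrite wE memS //; lia.
    rewrite (_ : i = a.-1); last by lia.
    by rewrite Nlast => /eqP wE; move: wS; rewrite wE memS //; lia.
  have iw : (index w S < a)%N by rewrite index_mem.
  rewrite -{1}(nth_index p wS); move: (index w S) iw => j ja.
  have [i0|i0] := posnP i.
    by rewrite i0 [nth p S 0%N]/= N0 uS //; lia.
  have i1 : (i.-1 < a)%N by lia.
  have [il|il] := ltnP i.+1 a.
    by rewrite Nint // !uS //; lia.
  rewrite (_ : i = a.-1); last by lia.
  by rewrite Nlast uS //; lia.
exists S => //; split=> //.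
- move=> v vS w wD; rewrite -[in RHS](nth_index p vS) index_uniq ?index_mem //.
  by rewrite -adjS ?index_mem // nth_index // /r (SD _ vS) wD !andbT.
- move=> v vD vS; case: (dg v vD) => // dv; exfalso.
  pose z := nth p S a.-1.
  have zS : z \in S by rewrite mem_nth //; lia.
  have zD : z \notin D := SD _ zS.
  have Nz : #|N z| = 1%N.
    rewrite (_ : N z = [set nth p S a.-2]) ?cards1 //.
    by apply/setP=> w; rewrite !inE Nlast.
  have dz : deg e z = (#|D| + 1)%N by rewrite cN // Nz.
  have pz : p != z by rewrite -[p]/(nth p S 0%N) uS //; apply/eqP; lia.
  have pS : p \in S by rewrite inE eqxx.
  (* A vertex of degree one off the path would be a third one. *)
  have : (#|[set v; p; z]| <= 2)%N.
    rewrite -two; apply: subset_leq_card; apply/subsetP=> u; rewrite !inE.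
    by case/orP=> [/orP[] /eqP->|/eqP->]; rewrite ?vD ?pD ?zD ?dv ?dp ?dz eqxx.
  rewrite -setUA cardsU1 cards2 pz !inE negb_or.
  have -> : v != p by apply: contraNneq vS => ->.
  by have -> : v != z by apply: contraNneq vS => ->.
Qed.

Lemma path_in_join_iso (m n : nat) (e : rel 'I_(m + n)) (D : {set 'I_(m + n)}) s :
  simple_graph e -> path_in_join e D s -> #|D| = m -> size s = n ->
  graph_iso e (join_KP_rel m n).
Proof.
move=> ge pj Dm sn.
have full v : (v \in s) = (v \notin D).
  have /eqP/setP/(_ v) : [set u in s] == ~: D.
    rewrite eqEcard; apply/andP; split.
      by apply/subsetP=> u; rewrite !inE => /(pj_disj pj).
    have -> : #|[set u in s]| = n by rewrite cardsE (card_uniqP (pj_uniq pj)) sn.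
    by rewrite -(leq_add2l #|D|) cardsC card_ord Dm.
  by rewrite !inE.
pose F v := if v \in D then index v (enum D) else (m + index v s)%N.
have FD v : v \in D -> (F v < m)%N.
  by move=> vD; rewrite /F vD -[X in (_ < X)%N]Dm cardE index_mem mem_enum.
have bnd v : (F v < m + n)%N.
  case: (boolP (v \in D)) => vD; first by rewrite (leq_trans (FD _ vD)) ?leq_addr.
  by rewrite /F (negPf vD) ltn_add2l -[X in (_ < X)%N]sn index_mem full.
have Fout v : v \notin D -> F v = (m + index v s)%N by rewrite /F => /negPf->.
pose f v := Ordinal (bnd v).
have finj : injective f.
  move=> u v [] E; case: (boolP (u \in D)) (boolP (v \in D)) => uD [] vD.
  - move: E; rewrite /F uD vD => E.
    have uE : u \in enum D by rewrite mem_enum.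
    by rewrite -(nth_index u uE) E nth_index ?mem_enum.
  - by have := FD _ uD; rewrite E (Fout _ vD); lia.
  - by have := FD _ vD; rewrite -E (Fout _ uD); lia.
  - move: E; rewrite !Fout // => /eqP; rewrite eqn_add2l => /eqP E.
    have us : u \in s by rewrite full.
    by rewrite -(nth_index u us) E nth_index ?full.
exists f; split; first exact: injF_bij.
move=> u v; rewrite /join_KP_rel (inj_eq finj) /=.
case: (boolP (u \in D)) => uD.
  by rewrite FD // andbT (adj_dominating ge pj) // eq_sym.
case: (boolP (v \in D)) => vD.
  by rewrite (FD v) // orbT andbT (adj_sym ge) (adj_dominating ge pj).
rewrite (pj_adj pj) ?full // vD /= !Fout //; have [->|_] := eqVneq u v.
  by move: (index v s) => i; lia.
by move: (index u s) (index v s) => i j; lia.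
Qed.

(** * Degrees of cospectral graphs *)

(** Traces of the first three powers: each of the first two yields a new degree sum since alpha is
    nonzero, and the third leaves a balance between cubes and triangles. *)
Lemma cospectral_degree_sums (R : rcfType) (alpha : R) (k : nat) (e e' : rel 'I_k) :
  0 < alpha -> simple_graph e -> simple_graph e' ->
  char_poly (A_alpha alpha e) = char_poly (A_alpha alpha e') ->
  [/\ (\sum_v deg e v = \sum_v deg e' v)%N,
      (\sum_v deg e v ^ 2 = \sum_v deg e' v ^ 2)%N &
      alpha ^+ 3 * ((\sum_v deg e v ^ 3)%:R - (\sum_v deg e' v ^ 3)%:R) =
      (1 - alpha) ^+ 3 * ((\sum_v triwalks e' v)%:R - (\sum_v triwalks e v)%:R)].
Proof.
move=> a0 ge ge' cosp.
have [] := cospectral_traces (trmx_A_alpha alpha ge) (trmx_A_alpha alpha ge') cosp.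
rewrite !mxtrace_A_alpha // !mxtrace2_A_alpha // !mxtrace3_A_alpha //.
have an0 : alpha != 0 by rewrite gt_eqF.
move=> /(mulfI an0)/eqP; rewrite eqr_nat => /eqP E1.
rewrite E1 => /addIr/(mulfI (expf_neq0 2 an0))/eqP; rewrite eqr_nat => /eqP E2.
rewrite E2 => E3; split=> //; apply/eqP; rewrite -subr_eq0; apply/eqP.
by move/eqP: E3; rewrite -subr_eq0 => /eqP <-; ring.
Qed.

Lemma sum_deg_split (k : nat) (e : rel 'I_k) (D : {set 'I_k}) (F : nat -> int) :
  {in D, forall v, deg e v = k.-1} ->
  \sum_v F (deg e v) = F k.-1 *+ #|D| + \sum_(v | v \notin D) F (deg e v).
Proof.
move=> dD; rewrite (bigID (mem D)) /=; congr (_ + _).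
by rewrite (eq_bigr (fun=> F k.-1)) ?sumr_const // => v /dD ->.
Qed.

Lemma sum_outside_const (k : nat) (D : {set 'I_k}) (c : int) :
  \sum_(v : 'I_k | v \notin D) c = c *+ (k - #|D|).
Proof.
rewrite sumr_const; congr (_ *+ _).
by rewrite -[X in (X - _)%N]card_ord -(cardC (mem D)) addKn; apply: eq_card.
Qed.

Lemma full_path_degrees (k : nat) (e : rel 'I_k) (D : {set 'I_k}) (s : seq 'I_k) :
  simple_graph e -> path_in_join e D s -> (2 <= size s)%N ->
  (forall v, v \notin D -> v \in s) ->
  (forall v, v \notin D -> deg e v = (#|D| + 1)%N \/ deg e v = (#|D| + 2)%N) /\
  \sum_(v | v \notin D) (#|D|%:Z + 2 - (deg e v)%:Z) = 2.
Proof.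
move=> ge pj sz full; have [x0 _] : exists x0, x0 \in s.
  by case: s sz {pj full} => // x0 s _; exists x0; rewrite inE eqxx.
split=> [v vD|].
  have vs := full v vD; rewrite -(nth_index x0 vs) (deg_path x0 ge pj) ?index_mem //.
  have : (index v s < size s)%N by rewrite index_mem.
  move: (index v s) => i ia; case: (posnP i) => [->|i0] /=; first by rewrite sz; left.
  by case: (i.+1 < size s)%N; [right | left].
have := deficient_sum x0 ge pj (fun=> 1 : int) sz => E.
rewrite -[RHS]E; apply: eq_bigr => v _; lia.
Qed.

(** The product (d - m - 1)(d - m - 2) is nonnegative at integers, and its sum outside the clique is
    fixed by the sums of d and d^2. It is zero for [e], hence vanishes termwise for [e']; the total
    deficiency then counts the vertices of degree m + 1. *)
Lemma path_degrees_transfer (k : nat) (e e' : rel 'I_k) (D D' : {set 'I_k}) :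
  {in D, forall v, deg e v = k.-1} -> {in D', forall v, deg e' v = k.-1} ->
  #|D| = #|D'| ->
  (\sum_v deg e v = \sum_v deg e' v)%N ->
  (\sum_v deg e v ^ 2 = \sum_v deg e' v ^ 2)%N ->
  (forall v, v \notin D -> deg e v = (#|D| + 1)%N \/ deg e v = (#|D| + 2)%N) ->
  \sum_(v | v \notin D) (#|D|%:Z + 2 - (deg e v)%:Z) = 2 ->
  (forall v, v \notin D' -> deg e' v = (#|D'| + 1)%N \/ deg e' v = (#|D'| + 2)%N) /\
  #|[set v | (v \notin D') && (deg e' v == #|D'| + 1)%N]| = 2%N.
Proof.
move=> dD dD' DD' E1 E2 dout sout; rewrite -!DD'; set M := #|D|%:Z.
have eqF (A B C : int) : \sum_(v | v \notin D) (A * (deg e v)%:Z ^+ 2 + B * (deg e v)%:Z + C)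
    = \sum_(v | v \notin D') (A * (deg e' v)%:Z ^+ 2 + B * (deg e' v)%:Z + C).
  pose F j : int := A * j%:Z ^+ 2 + B * j%:Z + C.
  have : \sum_v F (deg e v) = \sum_v F (deg e' v).
    have sq (e1 : rel 'I_k) : \sum_v (deg e1 v)%:Z ^+ 2 = (\sum_v deg e1 v ^ 2)%N%:Z.
      by rewrite Posz_sum; apply: eq_bigr => v _; lia.
    by rewrite /F !big_split /= -!mulr_sumr !sq E2 -!Posz_sum E1.
  by rewrite (sum_deg_split F dD) (sum_deg_split F dD') DD' => /addrI.
have all0 : \sum_(v | v \notin D')
    (((deg e' v)%:Z - (M + 1)) * ((deg e' v)%:Z - (M + 2))) = 0.
  rewrite (eq_bigr (fun v => 1 * (deg e' v)%:Z ^+ 2 + (- (2 * M + 3)) * (deg e' v)%:Z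
     + (M + 1) * (M + 2))); last by move=> v _; ring.
  rewrite -eqF big1 // => v vD; case: (dout v vD) => ->; rewrite /M PoszD; ring.
have dout' v : v \notin D' -> deg e' v = (#|D| + 1)%N \/ deg e' v = (#|D| + 2)%N.
  move=> vD'; have ge0 u : u \notin D' ->
      0 <= ((deg e' u)%:Z - (M + 1)) * ((deg e' u)%:Z - (M + 2)).
    move=> _; have [h|h] := lerP (deg e' u)%:Z (M + 1).
      by rewrite mulr_le0 //; lia.
    by rewrite mulr_ge0 //; lia.
  have /eqP := psumr_eq0P ge0 all0 vD'; rewrite mulf_eq0 /M.
  by case/orP=> /eqP h; [left | right]; lia.
split=> //.
have s2 : \sum_(v | v \notin D') (M + 2 - (deg e' v)%:Z) = 2.
  rewrite -[RHS]sout -/M.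
  rewrite (eq_bigr (fun v => 0 * (deg e' v)%:Z ^+ 2 + (- 1) * (deg e' v)%:Z + (M + 2))).
    by rewrite -eqF; apply: eq_bigr => v _; ring.
  by move=> v _; ring.
apply/eqP; rewrite -eqz_nat -sum1dep_card -[X in _ == X]s2 (big_morph Posz PoszD (erefl _)).
rewrite big_mkcondr /=; apply/eqP; apply: eq_bigr => v vD'.
by case: (dout' v vD') => ->; rewrite eqn_add2l /M /=; lia.
Qed.

Lemma exists_subset_card (T : finType) (A : {set T}) (m : nat) : (m <= #|A|)%N ->
  exists2 D : {set T}, D \subset A & #|D| = m.
Proof.
move=> mA; exists [set x in take m (enum A)].
  by apply/subsetP=> x; rewrite inE => /mem_take; rewrite mem_enum.
rewrite cardsE; have /card_uniqP -> : uniq (take m (enum A)) by rewrite take_uniq ?enum_uniq.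
by rewrite size_takel -?cardE.
Qed.

Lemma fan_cospectral_dominating (R : rcfType) (alpha : R) (n : nat) (e : rel 'I_(1 + n)) :
  1 / 2 < alpha -> alpha < 1 -> (2 <= n)%N -> simple_graph e ->
  char_poly (A_alpha alpha (join_KP_rel 1 n)) = char_poly (A_alpha alpha e) ->
  exists v, dominating e v.
Proof.
move=> al au n2 ge cosp; have gF := join_KP_simple 1 n.
have a0 : 0 < alpha by lra.
apply/existsP; rewrite -[X in is_true X]negbK negb_exists; apply/negP=> /forallP nd.
set f := join_KP_rel 1 n in cosp gF.
have pj := path_in_join_KP 1 n; rewrite -/f in pj.
set D := KP_clique 1 n in pj; have cD : #|D| = 1%N := card_KP_clique 1 n.
have dD : {in D, forall v, deg f v = n} by move=> v vD; rewrite (deg_dominating gF pj).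
have [| |dout sout] := full_path_degrees gF pj; first by rewrite size_KP_path.
  by move=> v vD; rewrite KP_path_outside.
have [E1 E2 E3] := cospectral_degree_sums a0 gF ge cosp.
have s0 c : \sum_(v : 'I_(1 + n) | v \notin D) (c : int) = c * n%:Z.
  by rewrite sum_outside_const cD add1n subn1 -mulr_natr /= natz.
have s1 : \sum_(v | v \notin D) (deg f v)%:Z = 3 * n%:Z - 2.
  by move: sout; rewrite cD sumrB s0; move: (\sum_(i | _) _) => Q; lia.
have F1 : (\sum_v deg f v + 2 = 4 * n)%N.
  apply/eqP; rewrite -eqz_nat PoszD Posz_sum (sum_deg_split Posz dD) cD s1; lia.
have F2 : (\sum_v deg f v ^ 2 + 10 = n ^ 2 + 9 * n)%N.
  apply/eqP; rewrite -eqz_nat PoszD Posz_sum (sum_deg_split (fun j => Posz (j ^ 2)) dD) cD.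
  (* At d = 2, 3 one has d^2 = 5 d - 6, and likewise d^3 = 19 d - 30 below. *)
  rewrite (eq_bigr (fun v => 5 * (deg f v)%:Z - 6)); last first.
    by move=> v vD; case: (dout v vD) => ->; rewrite cD.
  by rewrite sumrB s0 -mulr_sumr s1; lia.
have F3 : (\sum_v deg f v ^ 3 + 38 = n ^ 3 + 27 * n)%N.
  apply/eqP; rewrite -eqz_nat PoszD Posz_sum (sum_deg_split (fun j => Posz (j ^ 3)) dD) cD.
  rewrite (eq_bigr (fun v => 19 * (deg f v)%:Z - 30)); last first.
    by move=> v vD; case: (dout v vD) => ->; rewrite cD.
  by rewrite sumrB s0 -mulr_sumr s1; lia.
(* The centre contributes (4n - 2) - 2n = 2n - 2 and the path vertices at least 4n - 4. *)
have FT : (6 * n <= \sum_v triwalks f v + 6)%N.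
  have [c cDE] : exists c, c \in D by apply/card_gt0P; rewrite cD.
  have domc := pj_dom pj cDE.
  have Tc := triwalks_dominating gF domc.
  rewrite (dD c cDE) in Tc.
  have : (\sum_(v | v != c) 2 * (deg f v).-1 <= \sum_(v | v != c) triwalks f v)%N.
    by apply: leq_sum => v vc; apply: (triwalks_ge gF domc vc).
  have -> : (\sum_(v | v != c) 2 * (deg f v).-1 = 4 * n - 4)%N.
    have DE : D = [set c].
      by apply/esym/eqP; rewrite eqEcard sub1set cDE cards1 cD.
    apply/eqP; rewrite -eqz_nat (big_morph Posz PoszD (erefl _)).
    rewrite (eq_bigl (fun v => v \notin D)); last by move=> v; rewrite DE inE.
    rewrite (eq_bigr (fun v => 2 * (deg f v)%:Z - 2)); last first.
      by move=> v vD; case: (dout v vD) => ->; rewrite cD.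
    by rewrite sumrB s0 -mulr_sumr s1; lia.
  rewrite [in X in _ -> X](bigD1 c) //=; lia.
have [] := no_dominating_bounds n2 ge nd; rewrite -?E1 -?E2 //.
rewrite -F3 ltn_add2r => lt3 le3.
move: E3 lt3 le3 FT F3.
move: (\sum_v triwalks e v)%N (\sum_v triwalks f v)%N (\sum_v deg e v ^ 3)%N
  (\sum_v deg f v ^ 3)%N => t' t d' d E lt le FT F3.
have {FT F3} : (t' + d' <= t + d)%N by move: (n ^ 3)%N le FT F3 => q; lia.
rewrite -(ler_nat R) !natrD; move: lt; rewrite -(ltr_nat R) {le}.
move: t'%:R t%:R d'%:R d%:R E => {}t' {}t {}d' {}d E lt le.
have ab : (1 - alpha) ^+ 3 < alpha ^+ 3 by rewrite ltr_pXn2r ?nnegrE //; lra.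
have b3 : 0 <= (1 - alpha) ^+ 3 by rewrite exprn_ge0 //; lra.
(* Since t' - t <= d - d' with d' < d, the third moment would give alpha^3 <= (1 - alpha)^3. *)
have : (1 - alpha) ^+ 3 * (t' - t) <= (1 - alpha) ^+ 3 * (d - d') by rewrite ler_wpM2l //; lra.
rewrite -E ler_pM2r ?subr_gt0 //; lra.
Qed.

(** Test vectors: a dominating vertex gives alpha (k - 1) <= lam. The indicator of the vertices off
    [D] and [s], nonempty by [z0], has Rayleigh quotient alpha m + 2; equality would make it an
    eigenvector, but its image is nonzero at [v0], where it vanishes. *)
Lemma top_eigenvalue_bounds (R : rcfType) (alpha : R) (k : nat) (e : rel 'I_k)
    (D : {set 'I_k}) (s : seq 'I_k) (v0 z0 : 'I_k) (lam : R) :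
  0 < alpha -> alpha < 1 -> simple_graph e -> path_in_join e D s ->
  v0 \in D -> z0 \notin D -> z0 \notin s ->
  (forall x, qform (A_alpha alpha e) x <= lam * sqnorm x) ->
  (forall x, qform (A_alpha alpha e) x = lam * sqnorm x ->
     x *m A_alpha alpha e = lam *: x) ->
  alpha * #|D|%:R + 2 < lam /\ alpha * k%:R - 1 < lam.
Proof.
move=> a0 a1 ge pj v0D z0D z0s lamle lameq; split; last first.
  have := lamle (delta_mx 0 v0).
  have -> : sqnorm (delta_mx 0 v0 : 'rV[R]_k) = 1.
    rewrite /sqnorm (bigD1 v0) //= mxE !eqxx expr1n big1 ?addr0 // => i iv.
    by rewrite mxE eqxx (negPf iv) expr0n.
  rewrite /qform -rowE trmx_delta -colE !mxE !eqxx mul1r mulr1 (adj_irr ge) mulr0 addr0.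
  rewrite (deg_dominating ge pj v0D).
  have k0 : (0 < k)%N by case: (k) v0 {v0D} => [[]|].
  have -> : k%:R = k.-1%:R + 1 :> R by rewrite natr1 prednK.
  lra.
pose Z : {set 'I_k} := [set v | (v \notin D) && (v \notin s)].
pose y : 'rV[R]_k := \row_i (i \in Z)%:R.
have z0Z : z0 \in Z by rewrite inE z0D.
have Zpos : 0 < #|Z|%:R :> R by rewrite ltr0n; apply/card_gt0P; exists z0.
have yE i : y 0 i = (i \in Z)%:R by rewrite mxE.
have cZ : #|Z|%:R = \sum_i (i \in Z)%:R :> R.
  by rewrite -sum1_card natr_sum big_mkcond; apply: eq_bigr => w _; case: (w \in Z).
have row_in j : j \in Z -> (y *m A_alpha alpha e) 0 j = alpha * #|D|%:R + 2.
  move=> jZ; have /andP[jD js] : (j \notin D) && (j \notin s) by move: jZ; rewrite inE.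
  have d2 := pj_rest pj jD js.
  have yD w : w \in D -> y 0 w = 0 by rewrite yE inE => ->.
  rewrite (row_A_alphaE _ ge) (sum_adj_outside ge pj _ jD) [X in _ * (X + _)]big1 // add0r.
  have : \sum_w (e j w)%:R * 1 = #|D|%:R + 2 :> R.
    by under eq_bigr do rewrite mulr1; rewrite -degR d2 natrD.
  rewrite (sum_adj_outside ge pj _ jD) sumr_const => /addrI E.
  rewrite (eq_bigr (fun w => (e j w)%:R * 1)); last first.
    move=> w wD; rewrite yE inE wD /=; case: (boolP (w \in s)) => //= ws.
    by rewrite (adj_sym ge) (pj_adj pj) // (negPf js) !mul0r.
  by rewrite E d2 yE jZ natrD mulr1; ring.
have nrm : sqnorm y = #|Z|%:R.
  rewrite /sqnorm cZ; apply: eq_bigr => i _; rewrite yE.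
  by case: (i \in Z); rewrite ?expr1n ?expr0n.
have qf : qform (A_alpha alpha e) y = (alpha * #|D|%:R + 2) * #|Z|%:R.
  rewrite /qform mxE cZ mulr_sumr.
  apply: eq_bigr => i _; rewrite [y^T i 0]mxE yE.
  by case: (boolP (i \in Z)) => [/row_in ->|_]; rewrite ?mulr0 ?mulr1.
rewrite ltNge; apply/negP=> lam_le.
have /lameq : qform (A_alpha alpha e) y = lam * sqnorm y.
  by apply/eqP; rewrite eq_le lamle nrm qf ler_pM2r.
move/rowP/(_ v0); rewrite (row_A_alphaE _ ge) [RHS]mxE yE inE v0D /= !mulr0 add0r => /eqP.
rewrite mulf_eq0 subr_eq0 [1 == alpha]eq_sym (lt_eqF a1) /=.
rewrite (eq_bigr (fun w => (w \in Z)%:R)); last first.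
  move=> w _; rewrite yE (adj_dominating ge pj) //.
  case: (boolP (w \in Z)) => [|_]; last by rewrite mulr0.
  rewrite inE => /andP[wD _]; rewrite [w != v0](_ : _ = true) ?mul1r //.
  by apply: contraNneq wD => ->.
by rewrite -cZ gt_eqF.
Qed.

(** If the component were shorter than n, the normalized top eigenvectors of the two graphs would
    give one recurrent sequence symmetric about two different centres. *)
Lemma path_component_spans (R : rcfType) (alpha : R) (m n : nat)
    (e : rel 'I_(m + n)) (D : {set 'I_(m + n)}) (s : seq 'I_(m + n)) :
  0 < alpha -> alpha < 1 -> (0 < m)%N -> (2 <= n)%N -> simple_graph e ->
  char_poly (A_alpha alpha (join_KP_rel m n)) = char_poly (A_alpha alpha e) ->
  #|D| = m -> path_in_join e D s -> (2 <= size s)%N -> size s = n.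
Proof.
move=> a0 a1 m0 n2 ge cosp cD pj sz; have gF := join_KP_simple m n.
have cS : #|[set u in s]| = size s by rewrite cardsE (card_uniqP (pj_uniq pj)).
have cDC : #|~: D| = n.
  by apply/eqP; rewrite -(eqn_add2l #|D|) cardsC card_ord cD.
have sub : [set u in s] \subset ~: D.
  by apply/subsetP=> u; rewrite !inE => /(pj_disj pj).
have : (size s <= n)%N by rewrite -cS -[X in (_ <= X)%N]cDC subset_leq_card.
rewrite leq_eqVlt => /orP[/eqP //|lt_sn]; exfalso.
have /set0Pn[z0] : ~: D :\: [set u in s] != set0.
  by rewrite -card_gt0 cardsDS // subn_gt0 cS cDC.
rewrite !inE => /andP[z0s z0D].
have [v0 v0D] : exists v0, v0 \in D by apply/card_gt0P; rewrite cD.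
have N0 : (0 < m + n)%N by rewrite addn_gt0 m0.
have [lam [[x xn0 xA] [x' x'n0 x'A] lamle lameq]] :=
  cospectral_top (trmx_A_alpha alpha gF) (trmx_A_alpha alpha ge) cosp N0.
have [l1 l2] := top_eigenvalue_bounds a0 a1 ge pj v0D z0D z0s lamle lameq.
have pjF := path_in_join_KP m n; have cF := card_KP_clique m n.
have szF : (2 <= size (KP_path m n))%N by rewrite size_KP_path.
have D0 : (0 < #|D|)%N by rewrite cD.
have F0 : (0 < #|KP_clique m n|)%N by rewrite cF.
have l1F : alpha * #|KP_clique m n|%:R + 2 < lam by rewrite cF -[m in m%:R]cD.
have sn0 := sigma_neq0 v0 gF a0 a1 pjF szF xA l1F l2 xn0.
have sn0' := sigma_neq0 v0 ge a0 a1 pj sz x'A l1 l2 x'n0.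
have normalize (B : 'M[R]_(m + n)) (u : 'rV_(m + n)) (E : {set 'I_(m + n)}) :
    u *m B = lam *: u -> \sum_(v in E) u 0 v != 0 ->
    exists2 u' : 'rV_(m + n), u' *m B = lam *: u' & \sum_(v in E) u' 0 v = 1.
  move=> uB u0; exists ((\sum_(v in E) u 0 v)^-1 *: u).
    by rewrite -scalemxAl uB !scalerA mulrC.
  by under eq_bigr do rewrite mxE; rewrite -mulr_sumr mulVf.
have [w wA w1] := normalize _ _ _ xA sn0.
have [w' w'A w'1] := normalize _ _ _ x'A sn0'.
have := eigen_path_symmetric v0 gF a0 a1 pjF szF wA l1F l2 F0 w1.
have := eigen_path_symmetric v0 ge a0 a1 pj sz w'A l1 l2 D0 w'1.
rewrite /= cF cD size_KP_path; rewrite cD in l1.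
set t := lam - _ - _; set b := 1 - alpha.
have t0 : 0 < t by rewrite /t; lra.
have b0 : 0 < b by rewrite /b; lra.
move=> [fa fa1] [fn fn1].
have tau2 : 2 < (t + 2 * b) / b by rewrite ltr_pdivlMr //; lra.
have [p00 p10] := linrec_two_symmetries tau2 lt_sn fa fa1 fn fn1.
(* With [p1] zero, [p0] is a nonzero multiple of b / t, which is positive. *)
move/eqP: p00; rewrite p10 mulr0 subr0 !mulf_eq0 invr_eq0 pnatr_eq0 /=.
by rewrite invr_eq0 !gt_eqF.
Qed.

(** Degrees never exceed those of the complete graph, so equal degree sums force equality at every
    vertex. *)
Lemma complete_iso (k : nat) (e e' : rel 'I_k) :
  (forall x y, e' x y = (x != y)) -> simple_graph e ->
  (\sum_v deg e v = \sum_v deg e' v)%N -> graph_iso e e'.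
Proof.
move=> e'E ge E; exists id; split; first by exists id.
move=> x y; rewrite e'E.
have de' v : deg e' v = k.-1.
  rewrite /deg (_ : [set j | e' v j] = [set~ v]) ?cardsC1 ?card_ord //.
  by apply/setP=> w; rewrite !inE e'E eq_sym.
have dle v : (deg e v <= deg e' v)%N.
  apply: subset_leq_card; apply/subsetP=> w; rewrite !inE e'E => evw.
  by apply: contraTneq evw => ->; rewrite (adj_irr ge).
have /eqP := E.
have /leqif_sum : forall v, true -> (deg e v <= deg e' v ?= iff (deg e v == deg e' v))%N.
  by move=> v _; apply: leqif_eq.
move=> [_ ->] /forallP/(_ x)/eqP dx.
have /eqP/setP/(_ y) : [set j | e x j] == [set j | e' x j].
  rewrite eqEcard; apply/andP; split; last by rewrite -/(deg e x) -/(deg e' x) dx.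
  apply/subsetP=> w; rewrite !inE e'E => evw.
  by apply: contraTneq evw => ->; rewrite (adj_irr ge).
by rewrite !inE e'E => ->.
Qed.

Theorem theorem3p12 (R : rcfType) (m n : nat) :
  (1 <= m)%N -> (1 <= n)%N ->
  forall alpha : R, 1 / 2 < alpha < 1 -> DAS alpha (join_KP_rel m n).
Proof.
move=> m0 n0 alpha /andP[al a1] k' e' ge' cosp.
have a0 : 0 < alpha by lra.
have k'E : k' = (m + n)%N.
  by have := congr1 (fun p : {poly R} => size p) cosp; rewrite !size_char_poly => -[].
subst k'; have gF := join_KP_simple m n.
have cosp' : char_poly (A_alpha alpha (join_KP_rel m n)) = char_poly (A_alpha alpha e').
  exact: esym cosp.
have [E1 E2 _] := cospectral_degree_sums a0 gF ge' cosp'.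
(* For n = 1 the join is complete. *)
move: n0; rewrite leq_eqVlt => /orP[/eqP n1|n2].
  apply: complete_iso => // x y; rewrite /join_KP_rel.
  case: eqVneq => //= xy.
  have : (x : nat) <> y by move=> h; case/eqP: xy; apply: val_inj.
  by have := ltn_ord x; have := ltn_ord y; lia.
pose A := [set v | dominating e' v].
have pjF := path_in_join_KP m n; have cF := card_KP_clique m n.
have mA : (m <= #|A|)%N.
  have := cospectral_dominating al a1 gF ge' (pj_dom pjF) cosp'; rewrite cF -/A.
  have [A0|] := posnP #|A|; last by lia.
  rewrite A0 /= => m1; have {}m1 : m = 1%N by lia.
  subst m; have [v dv] := fan_cospectral_dominating al a1 n2 ge' cosp'.
  have : v \in A by rewrite inE.
  by rewrite (cards0_eq A0) inE.
(* Exactly m dominating vertices are chosen as the clique; there may be more, since a short path has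
   dominating vertices of its own. *)
have [D /subsetP DA cD] := exists_subset_card mA.
have domD : {in D, forall v, dominating e' v} by move=> v /DA; rewrite inE.
have dgD : {in D, forall v, deg e' v = (m + n).-1}.
  move=> v /domD/forallP dv; rewrite /deg (_ : [set j | e' v j] = [set~ v]).
    by rewrite cardsC1 card_ord.
  apply/setP=> w; rewrite !inE; have := dv w.
  by case: eqVneq => [->|] //= _; rewrite (adj_irr ge').
have dgF : {in KP_clique m n, forall v, deg (join_KP_rel m n) v = (m + n).-1}.
  by move=> v vD; rewrite (deg_dominating gF pjF).
have [| |dout sout] := full_path_degrees gF pjF; first by rewrite size_KP_path.
  by move=> v vD; rewrite KP_path_outside.
have [dout' two] := path_degrees_transfer dgF dgD (etrans cF (esym cD)) E1 E2 dout sout.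
have [p] : exists p, p \in [set v | (v \notin D) && (deg e' v == #|D| + 1)%N].
  by apply/card_gt0P; rewrite two.
rewrite inE => /andP[pD /eqP dp].
have [s pj sz] := path_component ge' domD dout' two pD dp.
apply: (path_in_join_iso ge' pj cD).
exact: (path_component_spans a0 a1 m0 n2 ge' cosp' cD pj sz).
Qed.
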